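(* If each $2\times 2$ sub-net of an $m\times n$ net in $\mathbb{R}^d$ is deformable, then the $m\times n$ net is deformable.
   Context: An $m\times n$ net is a collection of $(m+1)(n+1)$ points $P_{ij}\in\mathbb{R}^d$, $0\le i\le m$, $0\le j\le n$ (not necessarily distinct), such that for all $0\le i<m$, $0\le j<n$ the points $P_{ij},P_{i+1,j},P_{i+1,j+1},P_{i,j+1}$ are consecutive vertices of a convex (planar, non-degenerate) quadrilateral. These quadrilaterals are the faces and their sides are the edges; they are labeled by the indices of their vertices. Faces or edges of two $m\times n$ nets spanned by points with the same indices are called corresponding. An $a\times b$ sub-net of an $m\times n$ net $P_{ij}$ is the $a\times b$ net formed by the points $P_{ij}$ with $p\le i\le p+a$, $q\le j\le q+b$, for some integers $0\le p\le m-a$ and $0\le q\le n-b$. Two $m\times n$ nets are parallel (Combescure transformations of each other) if their corresponding edges are parallel. They are congruent if there is an isometry of $\mathbb{R}^d$ taking each point of the first net to the point of the second net with the same indices. An $m\times n$ net is deformable if it is contained in a continuous family of non-congruent parallel $m\times n$ nets with the same areas of corresponding faces. *)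

(* Defs.v *)
From HB Require Import structures.
From mathcomp Require Import all_boot all_order all_algebra.
From mathcomp Require Import all_classical all_reals all_analysis.

Set Implicit Arguments.
Unset Strict Implicit.
Unset Printing Implicit Defensive.

Import Order.TTheory GRing.Theory Num.Theory.
Import numFieldNormedType.Exports.

Local Open Scope classical_set_scope.
Local Open Scope ring_scope.

Section Nets.
Variables (R : realType) (d : nat).

Notation point := 'rV[R]_d.

(* The library's norm on 'rV[R]_d is the sup norm, so the Euclidean structure
   of R^d is introduced here; both induce the same topology. *)
Definition dot (u v : point) : R := \sum_(k < d) u 0 k * v 0 k.

Definition edist (A B : point) : R := Num.sqrt (dot (B - A) (B - A)).

Definition is_isometry (f : point -> point) : Prop :=
  forall A B : point, edist (f A) (f B) = edist A B.

Definition collinear (A B C : point) : Prop :=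
  exists (p v : point) (a b c : R),
    [/\ A = p + a *: v, B = p + b *: v & C = p + c *: v].

(* No three of the vertices are collinear, and the diagonals AC and BD meet at
   a point interior to both; the latter also makes A, B, C, D coplanar and
   fixes their cyclic order. *)
Definition convex_quad (A B C D : point) : Prop :=
  [/\ ~ collinear A B C, ~ collinear B C D,
      ~ collinear C D A, ~ collinear D A B &
      exists s t : R, [/\ 0 < s < 1, 0 < t < 1 &
        A + s *: (C - A) = B + t *: (D - B)]].

(* Half the square root of the Gram determinant of B - A and C - A. *)
Definition triangle_area (A B C : point) : R :=
  Num.sqrt (dot (B - A) (B - A) * dot (C - A) (C - A)
            - dot (B - A) (C - A) ^+ 2) / 2.

Definition quad_area (A B C D : point) : R :=
  triangle_area A B C + triangle_area A C D.

(* For nonzero vectors, as edges of nets are. *)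
Definition parallel_vectors (u v : point) : Prop :=
  exists2 c : R, c != 0 & v = c *: u.

(* An m x n net is given by a function nat -> nat -> R^d; only the values at
   i <= m and j <= n are relevant, and every predicate below depends on those
   values only. *)
Implicit Types (m n : nat) (P Q : nat -> nat -> point).

Definition is_net m n P : Prop :=
  forall i j, (i < m)%N -> (j < n)%N ->
    convex_quad (P i j) (P i.+1 j) (P i.+1 j.+1) (P i j.+1).

Definition same_points m n P Q : Prop :=
  forall i j, (i <= m)%N -> (j <= n)%N -> P i j = Q i j.

(* The p, q-th sub-net of any size; its size is supplied separately. *)
Definition subnet (p q : nat) P : nat -> nat -> point :=
  fun i j => P (p + i)%N (q + j)%N.

(* For m, n > 0 the edges (sides of the faces) are the segments joining points
   whose indices are adjacent in the grid. *)
Definition parallel_nets m n P Q : Prop :=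
  (forall i j, (i < m)%N -> (j <= n)%N ->
     parallel_vectors (P i.+1 j - P i j) (Q i.+1 j - Q i j)) /\
  (forall i j, (i <= m)%N -> (j < n)%N ->
     parallel_vectors (P i j.+1 - P i j) (Q i j.+1 - Q i j)).

Definition same_areas m n P Q : Prop :=
  forall i j, (i < m)%N -> (j < n)%N ->
    quad_area (P i j) (P i.+1 j) (P i.+1 j.+1) (P i j.+1) =
    quad_area (Q i j) (Q i.+1 j) (Q i.+1 j.+1) (Q i j.+1).

Definition congruent m n P Q : Prop :=
  exists2 f : point -> point, is_isometry f &
    forall i j, (i <= m)%N -> (j <= n)%N -> f (P i j) = Q i j.

(* The family is parametrized by a nondegenerate interval I of any kind, and
   the given net may correspond to any parameter in I, including an endpoint. *)
Definition deformable m n P : Prop :=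
  exists (I : set R) (F : R -> nat -> nat -> point),
    [/\ is_interval I /\ (exists s t, [/\ I s, I t & s < t]),
        exists2 t0, I t0 & same_points m n (F t0) P,
        forall i j, (i <= m)%N -> (j <= n)%N ->
          {within I, continuous (fun t => F t i j)},
        forall t, I t -> is_net m n (F t) &
        forall s t, I s -> I t -> s != t ->
          [/\ parallel_nets m n (F s) (F t),
              same_areas m n (F s) (F t) &
              ~ congruent m n (F s) (F t)]].

End Nets.

(* Main.v *)
Require Import Defs.
From mathcomp Require Import all_boot all_order all_algebra.
From mathcomp Require Import all_classical all_reals all_analysis.
From mathcomp Require Import ring lra.

(* In a family of parallel nets with the same face areas, a face is described,
   up to translation, by the ratios of its edges to the original ones, and the
   ratio of one edge determines those of the whole face: if the ratio of AB is
   fixed, the area increases strictly with the ratio of AD. Hence the ratio of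
   a single edge determines the deformation of the whole net, and the only
   obstructions are the inner vertices, where four faces have to fit together.
   The deformability of the 2 x 2 sub-net around a vertex removes the
   obstruction, but possibly only for ratios on one side of 1, and on
   different sides for different vertices. All ratios are however real
   analytic functions of the chosen one, obtained by nesting square roots and
   rational functions; so the faces around each vertex fit together on a
   neighbourhood of 1, which gives the deformation of the whole net. *)

Set Implicit Arguments.
Unset Strict Implicit.
Unset Printing Implicit Defensive.

Import Order.TTheory GRing.Theory Num.Theory.
Import numFieldNormedType.Exports.

Local Open Scope classical_set_scope.
Local Open Scope ring_scope.

(** * Real analytic functions near 0 *)

Section Analytic.
Variable R : realType.
Implicit Types (f g u : R -> R) (a b c : nat -> R -> R) (t M K L : R).

(** The Cauchy product of two coefficient sequences. *)
Definition conv a b (n : nat) : R -> R :=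
  fun t => \sum_(k < n.+1) a k t * b (n - k)%N t.

(** Leibniz's rule in terms of normalised derivatives: a product obeys the same recursion as its
    factors. *)
Lemma is_derive_conv a b n t :
  (forall k, (k <= n)%N -> is_derive t 1 (a k) (k.+1%:R * a k.+1 t)) ->
  (forall k, (k <= n)%N -> is_derive t 1 (b k) (k.+1%:R * b k.+1 t)) ->
  is_derive t 1 (conv a b n) (n.+1%:R * conv a b n.+1 t).
Proof.
move=> da db.
have -> : conv a b n = \sum_(k < n.+1) (a k * b (n - k)%N).
  by apply/funext => s; rewrite fct_sumE.
apply: (@is_derive_eq _ _ _ _ _ _ _
    (\sum_(k < n.+1) (a k t *: ((n - k).+1%:R * b (n - k).+1 t) +
                      b (n - k)%N t *: (k.+1%:R * a k.+1 t)))).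
  apply: is_derive_sum => k; apply: is_deriveM.
    exact/da/leq_ord.
  exact/db/leq_subr.
(* Split the factor [n.+1] as [k + (n.+1 - k)]. The first sum then loses its term [k = 0] and the
   second its term [k = n.+1]. *)
have -> : n.+1%:R * conv a b n.+1 t =
    \sum_(k < n.+2) k%:R * a k t * b (n.+1 - k)%N t +
    \sum_(k < n.+2) (n.+1 - k)%:R * a k t * b (n.+1 - k)%N t.
  rewrite -big_split /conv mulr_sumr; apply: eq_bigr => k _ /=.
  by rewrite natrB ?(leq_ord k)//; ring.
rewrite [X in _ = X + _]big_ord_recl [X in _ = _ + X]big_ord_recr /= subnn.
rewrite mulr0n !mul0r add0r addr0.
rewrite -big_split /=; apply: eq_bigr => k _ /=.
by rewrite /bump /= add1n subSS (subSn (leq_ord k)) /GRing.scale /=; ring.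
Qed.

Lemma sum_exp_le K L n : 0 < K -> 2 * K <= L ->
  \sum_(k < n.+1) K ^+ k * L ^+ (n - k) <= 2 * L ^+ n.
Proof.
move=> K0 KL.
have L0 : 0 < L by lra.
(* The extra term [- K ^+ n] is what makes the induction close. *)
suff : \sum_(k < n.+1) K ^+ k * L ^+ (n - k) <= 2 * L ^+ n - K ^+ n.
  by move=> /le_trans; apply; rewrite gerBl exprn_ge0// ltW.
elim: n => [|n ih]; first by rewrite big_ord1 !expr0; lra.
rewrite big_ord_recr /= subnn expr0 mulr1.
rewrite (eq_bigr (fun k : 'I_n.+1 => L * (K ^+ k * L ^+ (n - k)))); last first.
  by move=> k _; rewrite subSn ?(leq_ord k)// exprS; ring.
rewrite -mulr_sumr.
have := ler_wpM2l (ltW L0) ih.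
have : 2 * K * K ^+ n <= L * K ^+ n by rewrite ler_pM2r// exprn_gt0.
by rewrite !exprS; lra.
Qed.

(** For equal growth rates the number [n.+1] of summands would enter the bound. A rate [L] of at
    least [2 * K] turns the sum into a geometric one, so the product keeps the rate [L]. *)
Lemma norm_conv_le a b n t (A B : R) K L : 0 < K -> 2 * K <= L -> 0 <= A ->
  (forall k, (k <= n)%N -> `|a k t| <= A * K ^+ k) ->
  (forall k, (k <= n)%N -> `|b k t| <= B * L ^+ k) ->
  `|conv a b n t| <= 2 * A * B * L ^+ n.
Proof.
move=> K0 KL A0 ha hb.
have B0 : 0 <= B.
  by have := hb 0%N isT; rewrite expr0 mulr1; exact: le_trans.
apply: le_trans (ler_norm_sum _ _ _) _.
have -> : 2 * A * B * L ^+ n = A * B * (2 * L ^+ n) by ring.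
apply: le_trans (ler_wpM2l (mulr_ge0 A0 B0) (sum_exp_le n K0 KL)).
rewrite mulr_sumr; apply: ler_sum => k _; rewrite normrM.
apply: le_trans (ler_pM _ _ (ha _ (leq_ord k)) (hb _ (leq_subr k n))) _ => //.
by rewrite le_eqVlt; apply/orP; left; apply/eqP; ring.
Qed.

(* [a n] is the [n]-th derivative of [f] divided by [n!]; carrying the whole
   sequence replaces power series and their composition. *)
Definition analytic0 f : Prop :=
  exists a M K, [/\ a 0%N = f, 0 <= M, 0 < K &
    \forall t \near (0 : R), forall n,
      is_derive (t : R) (1 : R) (a n) (n.+1%:R * a n.+1 t) /\
      `|a n t| <= M * K ^+ n].

(** The coefficients of the derivative are [n.+1%:R * a n.+1]; doubling the growth rate absorbs the
    new factor, since [n.+1 <= 2 ^ n]. *)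
Lemma analytic0_deriv f : analytic0 f ->
  exists2 g, analytic0 g &
    \forall t \near (0 : R), is_derive (t : R) (1 : R) f (g t).
Proof.
move=> [a [M [K [<- M0 K0 H]]]].
exists (a 1%N); last first.
  by apply: filterS H => t /(_ 0%N) [+ _]; rewrite mul1r.
exists (fun n (t : R) => n.+1%:R * a n.+1 t), (M * K), (2 * K); split.
- by apply/funext => t; rewrite mul1r.
- by rewrite mulr_ge0// ltW.
- by rewrite mulr_gt0.
apply: filterS H => t H n; have [d _] := H n.+1; split.
  have -> : (fun t : R => n.+1%:R * a n.+1 t) = n.+1%:R \*: a n.+1 by [].
  by apply: is_derive_eq; rewrite /GRing.scale /=; ring.
have [_ Hn] := H n.+1.
rewrite normrM ger0_norm// exprMn.
have -> : M * K * (2 ^+ n * K ^+ n) = 2 ^+ n * (M * K ^+ n.+1).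
  by rewrite exprS; ring.
by rewrite ler_pM// -natrX ler_nat ltn_expl.
Qed.

Lemma analytic0_continuous f : analytic0 f ->
  \forall t \near (0 : R), {for t, continuous f}.
Proof.
move=> /analytic0_deriv [g _]; apply: filterS => t [df _].
exact/differentiable_continuous/derivable1_diffP.
Qed.

Lemma analytic0_continuous0 f : analytic0 f -> f t @[t --> (0 : R)] --> f 0.
Proof. by move=> /analytic0_continuous/nbhs_singleton. Qed.

Lemma analytic0_cst (c : R) : analytic0 (fun=> c).
Proof.
exists (fun n _ => if n is 0 then c else 0), `|c|, 1; split => //.
near=> t => n; split; last first.
  by case: n => [|n]; rewrite expr1n mulr1 ?normr0.
by rewrite mulr0; exact: is_derive_cst.
Unshelve. all: by end_near. Qed.

Lemma analytic0_id : analytic0 id.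
Proof.
exists (fun n => if n is n'.+1 then if n' is 0 then cst 1 else cst 0 else id),
  1, 1; split => //.
have := @nbhs0_le R R _ ltr01; apply: filterS => t t1 n; split; last first.
  by case: n => [|[|n]]; rewrite expr1n mulr1 ?normr1 ?normr0.
case: n => [|[|n]] /=; rewrite ?mulr0 ?mulr1.
- exact: is_derive_id.
- exact: is_derive_cst.
- exact: is_derive_cst.
Qed.

Lemma analytic0_add f g : analytic0 f -> analytic0 g ->
  analytic0 (fun t => f t + g t).
Proof.
move=> [a [M [K [<- M0 K0 H]]]] [b [N [L [<- N0 L0 H']]]].
exists (fun n (t : R) => a n t + b n t), (M + N), (Num.max K L); split => //.
- exact: addr_ge0.
- by rewrite lt_max K0.
apply: filterS2 H H' => t H H' n.
have [da ha] := H n.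
have [db hb] := H' n.
split.
  rewrite mulrDr.
  exact: is_deriveD da db.
apply: le_trans (ler_normD _ _) _; rewrite mulrDl lerD//.
  apply: le_trans ha _; rewrite ler_wpM2l// lerXn2r// ?nnegrE ?le_max ?lexx//.
    exact: ltW.
  by rewrite (ltW K0).
apply: le_trans hb _; rewrite ler_wpM2l// lerXn2r// ?nnegrE ?le_max ?lexx ?orbT//.
  exact: ltW.
by rewrite (ltW K0).
Qed.

Lemma analytic0_mul f g : analytic0 f -> analytic0 g ->
  analytic0 (fun t => f t * g t).
Proof.
move=> [a [M [K [<- M0 K0 H]]]] [b [N [L [<- N0 L0 H']]]].
exists (conv a b), (2 * M * N), (Num.max (2 * K) L); split => //.
- by apply/funext => t; rewrite /conv big_ord1.
- by rewrite !mulr_ge0.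
- by rewrite lt_max L0 orbT.
apply: filterS2 H H' => t H H' n.
split.
  have h1 k := (H k).1.
  have h2 k := (H' k).1.
  exact: (@is_derive_conv a b n t (fun k _ => h1 k) (fun k _ => h2 k)).
apply: (@norm_conv_le _ _ _ _ _ _ K) => //.
- by rewrite le_max lexx.
- by move=> k _; exact: (H k).2.
move=> k _; apply: le_trans (H' k).2 _.
apply: ler_wpM2l => //; apply: lerXn2r.
- by rewrite nnegrE ltW.
- by rewrite nnegrE le_max (ltW L0) orbT.
- by rewrite le_max lexx orbT.
Qed.

Lemma analytic0_opp f : analytic0 f -> analytic0 (fun t => - f t).
Proof.
move=> /(analytic0_mul (analytic0_cst (-1))).
by under eq_fun do rewrite mulN1r.
Qed.
Lemma eq_conv a a' b b' n t :
  (forall k, (k <= n)%N -> a k t = a' k t) ->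
  (forall k, (k <= n)%N -> b k t = b' k t) -> conv a b n t = conv a' b' n t.
Proof.
by move=> ea eb; apply: eq_bigr => k _; rewrite ea ?eb ?leq_subr ?leq_ord.
Qed.

(** The equation [u' = (g1 + g2 * u) * u], read off coefficient by coefficient, determines each
    coefficient of [u] from the earlier ones. *)
Lemma riccati_seq (g1 g2 : nat -> R -> R) u : exists c, c 0%N = u /\ forall n t,
  n.+1%:R * c n.+1 t = conv (fun k t => g1 k t + conv g2 c k t) c n t.
Proof.
pose next n (T : nat -> R -> R) : R -> R :=
  fun t => n.+1%:R^-1 * conv (fun k t => g1 k t + conv g2 T k t) T n t.
(* Course-of-values recursion: [table n] holds the right coefficients up to index [n], and its
   values beyond [n] are never read. *)
pose table := fix table n : nat -> R -> R := if n is m.+1 then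
  (fun k => if (k <= m)%N then table m k else next m (table m)) else fun=> u.
have tableE n k : (k <= n)%N -> table n k = table k k.
  elim: n => [|n ih]; first by rewrite leqn0 => /eqP ->.
  rewrite leq_eqVlt => /predU1P[-> //|]; rewrite ltnS => kn /=.
  by rewrite kn ih.
exists (fun n => table n n); split => // n t.
rewrite /= ltnn /next mulrA divff ?pnatr_eq0// mul1r.
apply: eq_conv => k kn; last by rewrite tableE.
congr (_ + _); apply: eq_conv => // i ik.
by rewrite tableE// (leq_trans ik).
Qed.

(* Covers both reciprocals ([g1 = 0]) and square roots ([g2 = 0]). *)
Lemma analytic0_riccati (g1 g2 u : R -> R) : analytic0 g1 -> analytic0 g2 ->
  (\forall t \near (0 : R),
     is_derive (t : R) (1 : R) u ((g1 t + g2 t * u t) * u t)) ->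
  analytic0 u.
Proof.
move=> [a [M [K [<- M0 K0 Ha]]]] [b [N [L [<- N0 L0 Hb]]]] Hu.
have [U U0 Ub] : exists2 U, 0 <= U & \forall t \near (0 : R), `|u t| <= U.
  have [du _] := nbhs_singleton Hu.
  have cu : u t @[t --> (0 : R)] --> u 0.
    exact/differentiable_continuous/derivable1_diffP.
  exists (`|u 0| + 1); first by rewrite addr_ge0.
  have /cvgrPdist_lt/(_ 1 ltr01) := cu; apply: filterS => t ut.
  rewrite -lerBlDl; apply: le_trans (ltW ut).
  by apply: le_trans (lerB_dist _ _) _; rewrite distrC.
have [c [c0 cS]] := riccati_seq a b u.
(* [H] bounds the coefficients of [g1 + g2 * u], the factor 2 coming from [norm_conv_le]. As
   [H <= B], the recursion reproduces the bound [U * B ^+ n]. *)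
pose H := M + 2 * N * U.
have H0 : 0 <= H by rewrite addr_ge0// !mulr_ge0.
pose B := Num.max (2 * L) (Num.max K H).
have [LB KB HB] : [/\ 2 * L <= B, K <= B & H <= B].
  by rewrite /B !le_max !lexx ?orbT.
have B0 : 0 < B by lra.
exists c, U, B; split => //.
apply: filterS3 (filterI Ha Hb) Hu Ub => t [{}Ha {}Hb] Hu Ub.
(* The given differential equation is the case [n = 0]. Each later coefficient is a Cauchy product
   of earlier ones, and Leibniz's rule gives its derivative. *)
have dc n : is_derive t 1 (c n) (n.+1%:R * c n.+1 t).
  elim/ltn_ind: n => n ih; case: n ih => [_|n ih].
    rewrite cS c0 /conv !big_ord1 /= ?subnn ?c0.
    exact: Hu.
  have dh k : (k <= n)%N -> is_derive t 1 (fun t => a k t + conv b c k t)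
      (k.+1%:R * (a k.+1 t + conv b c k.+1 t)).
    move=> kn; rewrite mulrDr; apply: is_deriveD; first exact: (Ha k).1.
    have h2 i := (Hb i).1.
    apply: (@is_derive_conv b c k t (fun k _ => h2 k)) => i ik.
    by apply: ih; rewrite ltnS (leq_trans ik).
  have := is_derive_conv dh (fun k kn => ih k kn).
  have -> : conv (fun k t => a k t + conv b c k t) c n = n.+1%:R \*: c n.+1.
    by apply/funext => s; rewrite -cS.
  rewrite -cS => dn.
  have -> : c n.+1 = n.+1%:R^-1 \*: (n.+1%:R \*: c n.+1).
    by apply/funext => s /=; rewrite scalerA mulVf ?pnatr_eq0// scale1r.
  apply: is_derive_eq (is_deriveZ _ dn) _.
  by rewrite /GRing.scale /= mulKf// pnatr_eq0.
move=> n; split=> //.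
elim/ltn_ind: n => n ih; case: n ih => [_|n ih]; first by rewrite c0 mulr1.
have bh k : (k <= n)%N -> `|a k t + conv b c k t| <= H * B ^+ k.
  move=> kn; apply: le_trans (ler_normD _ _) _; rewrite mulrDl; apply: lerD.
    apply: le_trans (Ha k).2 _; apply: ler_wpM2l => //; apply: lerXn2r => //.
      by rewrite nnegrE ltW.
    by rewrite nnegrE ltW.
  apply: (@norm_conv_le _ _ _ _ _ _ L) => // i ik; first exact: (Hb i).2.
  by apply: ih; rewrite ltnS (leq_trans ik).
suff : `|n.+1%:R * c n.+1 t| <= n.+1%:R * (U * B ^+ n.+1).
  by rewrite normrM ger0_norm// ler_pM2l.
rewrite cS; apply: le_trans (ler_norm_sum _ _ _) _.
have -> : n.+1%:R * (U * B ^+ n.+1) = \sum_(k < n.+1) U * B ^+ n.+1.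
  by rewrite sumr_const card_ord mulr_natl.
apply: ler_sum => k _; rewrite normrM.
apply: le_trans (ler_pM _ _ (bh _ (leq_ord k)) (ih _ _)) _ => //.
  by rewrite ltnS leq_subr.
have -> : H * B ^+ k * (U * B ^+ (n - k)) = H * (U * B ^+ n).
  have -> : B ^+ n = B ^+ k * B ^+ (n - k) by rewrite -exprD subnKC ?leq_ord.
  by ring.
rewrite exprS [leRHS]mulrCA; apply: ler_wpM2r => //.
by rewrite mulr_ge0// exprn_ge0// ltW.
Qed.

Lemma analytic0_inv f : analytic0 f -> f 0 != 0 ->
  analytic0 (fun t => (f t)^-1).
Proof.
move=> af f0; have [g ag df] := analytic0_deriv af.
have fn0 : \forall t \near (0 : R), f t != 0.
  have := analytic0_continuous0 af => /cvgrPdist_lt /(_ `|f 0|).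
  rewrite normr_gt0 => /(_ f0); apply: filterS => t; apply: contraTneq => ->.
  by rewrite subr0 ltxx.
(* The reciprocal solves [u' = (0 + (- f') * u) * u]. *)
apply: (analytic0_riccati (analytic0_cst 0)
  (analytic0_mul (analytic0_cst (-1)) ag)).
apply: filterS2 df fn0 => t [df dfE] ft0; split.
  exact: derivableV.
by rewrite deriveV// dfE /GRing.scale /=; field.
Qed.

Lemma analytic0_sqrt f : analytic0 f -> 0 < f 0 ->
  analytic0 (fun t => Num.sqrt (f t)).
Proof.
move=> af f0; have [g ag df] := analytic0_deriv af.
have fn0 : \forall t \near (0 : R), 0 < f t.
  have := analytic0_continuous0 af => /cvgrPdist_lt /(_ _ f0).
  by apply: filterS => t; rewrite ltr_norml => /andP[_]; lra.
(* The square root solves [u' = f' / (2 * f) * u]. *)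
have ah := analytic0_mul (analytic0_mul (analytic0_cst 2^-1) ag)
  (analytic0_inv af (lt0r_neq0 f0)).
apply: (analytic0_riccati ah (analytic0_cst 0)).
apply: filterS2 df fn0 => t df ft0.
have sf := is_derive1_sqrt ft0.
have -> : (fun t => Num.sqrt (f t)) = Num.sqrt \o f by [].
apply: is_derive_eq.
rewrite /GRing.scale /= mul0r addr0.
have s0 : Num.sqrt (f t) != 0 by rewrite gt_eqF// sqrtr_gt0.
have -> : (f t)^-1 = (Num.sqrt (f t))^-1 ^+ 2.
  by rewrite exprVn sqr_sqrtr// ltW.
by field.
Qed.

(** * The identity theorem *)

Lemma deriv_growth (F G : R -> R) (e C : R) (j : nat) (t : R) :
  (forall s : R, `|s| < e -> is_derive s 1 F (G s)) -> F 0 = 0 ->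
  (forall s : R, `|s| < e -> `|G s| <= C * `|s| ^+ j) ->
  `|t| < e -> j.+1%:R * `|F t| <= C * `|t| ^+ j.+1.
Proof.
move=> dF F0 bG te.
have [->|t0] := eqVneq t 0.
  by rewrite F0 !normr0 mulr0 exprS mul0r mulr0.
(* Cauchy's mean value theorem for [F] and the power [j.+1]: [E] takes the same value at 0 and [t],
   and a zero [c] of its derivative compares [F t] with [G c]. The factor [j.+1] is kept, as its
   accumulation yields binomial coefficients later. *)
pose E : R -> R := t ^+ j.+1 \*: F - F t \*: (@GRing.exp R ^~ j.+1).
have dE (s : R) : `|s| < e ->
    is_derive s 1 E (t ^+ j.+1 * G s - F t * (j.+1%:R * s ^+ j)).
  move=> se; have dFs := dF _ se.
  have -> : E = t ^+ j.+1 \*: F - F t \*: (id ^+ j.+1).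
    by apply/funext => x; rewrite /E /=; congr (_ - _ *: _); rewrite fctE.
  by apply: is_derive_eq; rewrite /GRing.scale /= mulr1.
have cE (s : R) : `|s| < e -> {for s, continuous E}.
  by move=> /dE [dEs _]; exact/differentiable_continuous/derivable1_diffP.
have E0t : E 0 = E t.
  by rewrite /E !fctE /= F0 expr0n /= !scaler0 subrr /GRing.scale /=; ring.
have sub (s : R) (p q : R) : s \in `[p, q] -> `|p| <= `|t| -> `|q| <= `|t| ->
    `|s| < e.
  rewrite in_itv /= => /andP[ps sq]; rewrite !ler_norml.
  move=> /andP[p1 p2] /andP[q1 q2].
  apply: le_lt_trans te; rewrite ler_norml; lra.
have rolle (p q : R) : p < q -> `|p| <= `|t| -> `|q| <= `|t| -> E p = E q ->
    exists2 c, c \in `]p, q[%R & t ^+ j.+1 * G c = F t * (j.+1%:R * c ^+ j).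
  move=> pq pt qt Epq.
  have [||c cpq [_ dc]] := @Rolle R E p q pq _ _ Epq.
  - move=> x xpq; have [] // := dE x.
    by apply: (sub x p q) => //; exact: subset_itv_oo_cc xpq.
  - apply: continuous_in_subspaceT => x /set_mem /= xpq; apply: cE.
    exact: (sub x p q).
  exists c => //; apply/eqP; rewrite -subr_eq0 -dc; apply/eqP.
  have ce : `|c| < e by apply: (sub c p q) => //; exact: subset_itv_oo_cc cpq.
  by have [_ <-] := dE c ce.
have [c [c0 ce Ec]] : exists c : R, [/\ c != 0, `|c| < e &
    t ^+ j.+1 * G c = F t * (j.+1%:R * c ^+ j)].
  case: (ltgtP t 0) t0 => // t0 _.
  - have [||c ct Ec] := rolle t 0 t0 _ _ (esym E0t); rewrite ?normr0//.
    exists c; split => //; first by rewrite lt_eqF ?(itvP ct).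
    by apply: (sub c t 0); rewrite ?normr0//; exact: subset_itv_oo_cc ct.
  - have [||c ct Ec] := rolle 0 t t0 _ _ E0t; rewrite ?normr0//.
    exists c; split => //; first by rewrite gt_eqF ?(itvP ct).
    by apply: (sub c 0 t); rewrite ?normr0//; exact: subset_itv_oo_cc ct.
have cj : 0 < `|c| ^+ j by rewrite exprn_gt0// normr_gt0.
rewrite -(ler_pM2r cj).
have /(congr1 Num.norm) := Ec; rewrite !normrM normr_nat !normrX => Ec'.
have -> : j.+1%:R * `|F t| * `|c| ^+ j = `|t| ^+ j.+1 * `|G c|.
  by rewrite Ec'; ring.
have -> : C * `|t| ^+ j.+1 * `|c| ^+ j = `|t| ^+ j.+1 * (C * `|c| ^+ j) by ring.
by apply: ler_wpM2l; rewrite ?exprn_ge0// bG.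
Qed.

Lemma analytic_flat a M K (e : R) : 0 < e -> 0 <= M -> 0 < K ->
  (forall t : R, `|t| < e -> forall n,
     is_derive t 1 (a n) (n.+1%:R * a n.+1 t) /\ `|a n t| <= M * K ^+ n) ->
  (forall n, a n 0 = 0) -> \forall t \near (0 : R), a 0%N t = 0.
Proof.
move=> e0 M0 K0 H a0.
(* Taylor estimate at a point where all derivatives vanish: each step in [j] integrates the bound
   for [a n.+1] once from 0. *)
have bnd j n t : `|t| < e ->
    `|a n t| <= M * K ^+ (n + j) * 'C(n + j, j)%:R * `|t| ^+ j.
  elim: j n t => [|j ih] n t te.
    by rewrite bin0 !mulr1 addn0; exact: (H t te n).2.
  have := @deriv_growth (a n) (fun s => n.+1%:R * a n.+1 s) e
    (n.+1%:R * (M * K ^+ (n.+1 + j) * 'C(n.+1 + j, j)%:R)) j t.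
  move=> /(_ (fun s se => (H s se n).1) (a0 n) _ te) h.
  suff : j.+1%:R * `|a n t| <=
      j.+1%:R * (M * K ^+ (n + j.+1) * 'C(n + j.+1, j.+1)%:R * `|t| ^+ j.+1).
    by rewrite ler_pM2l.
  apply: le_trans (h _) _.
    move=> s se; rewrite normrM normr_nat -mulrA; apply: ler_wpM2l => //.
    exact: ih.
  have /(congr1 (fun k => k%:R : R)) := mul_bin_left (n + j.+1) j.
  rewrite !natrM addnS subSn ?leq_addl// addnK => bin.
  rewrite addSn le_eqVlt; apply/orP; left; apply/eqP.
  have -> : forall x y z w v : R, x * (y * z * w) * v = x * w * (y * z * v).
    by move=> *; ring.
  by rewrite -bin; ring.
near=> t.
have te : `|t| < e by near: t; exact: (@nbhs0_lt R R).
have tK : `|t| <= (4 * K)^-1.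
  by near: t; apply: (@nbhs0_le R R); rewrite invr_gt0 mulr_gt0.
(* For [n = 0] the binomial coefficient is 1, so the bound decays geometrically in [j] once
   [K * |t|] is small. *)
have small j : `|a 0%N t| <= M * 2^-1 ^+ j.
  apply: le_trans (bnd j 0%N t te) _; rewrite add0n binn mulr1 -mulrA -exprMn.
  apply: ler_wpM2l => //; apply: lerXn2r; rewrite ?nnegrE ?invr_ge0//.
    by rewrite mulr_ge0// ltW.
  apply: le_trans (ler_wpM2l (ltW K0) tK) _.
  by rewrite invfM mulrCA divff ?gt_eqF// mulr1 lef_pV2 ?posrE//; lra.
apply/eqP; rewrite -normr_le0; apply/ler_addgt0Pl => d d0; rewrite addr0.
have c0 : M * 2^-1 ^+ j @[j --> \oo] --> (M * 0 : R).
  by apply: cvgMr; apply: cvg_expr; rewrite ger0_norm ?invr_ge0// invf_lt1 ?ltr1n.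
rewrite mulr0 in c0.
have /cvgrPdist_lt/(_ _ d0) [N _ /(_ N (leqnn N))] := c0.
rewrite /= sub0r normrN ger0_norm; last by rewrite mulr_ge0// exprn_ge0 ?invr_ge0.
by move=> /ltW; exact: le_trans.
Unshelve. all: by end_near. Qed.

(** All derivatives vanish inside the interval, hence at 0 by continuity, and the function is flat
    there. The point 0 may be an endpoint, so vanishing on one side is enough. *)
Lemma analytic0_eq0 f (l r : R) : analytic0 f -> l < r -> l <= 0 <= r ->
  (forall t, l < t < r -> f t = 0) -> \forall t \near (0 : R), f t = 0.
Proof.
move=> [a [M [K [<- M0 K0 /nbhs_ballP[e /= e0 H]]]]] lr /andP[l0 r0] f0.
have {}H (t : R) : `|t| < e -> forall n,
    is_derive t 1 (a n) (n.+1%:R * a n.+1 t) /\ `|a n t| <= M * K ^+ n.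
  by move=> te; apply: H; rewrite /ball /= sub0r normrN.
apply: (analytic_flat e0 M0 K0 H).
(* The interval is open, so a coefficient that vanishes on it has derivative zero there, and the
   next one vanishes too. *)
have an0 n (t : R) : l < t < r -> `|t| < e -> a n t = 0.
  elim: n t => [|n ih] t tlr te; first exact: f0.
  have : \forall s \near t, cst 0 s = a n s.
    have tl : \forall s \near t, s \in `]l, r[.
      by apply: near_in_itvoo; rewrite in_itv.
    have ne : \forall s \near t, s \in `](- e), e[.
      by apply: near_in_itvoo; rewrite in_itv/= -ltr_norml.
    apply: filterS2 tl ne => s; rewrite !in_itv /= -ltr_norml => *.
    by rewrite ih.
  move=> Ea; have [_ d0] := near_eq_is_derive Ea (is_derive_cst (0 : R) t (1 : R)).
  have [_] := (H t te n).1; rewrite d0 => /esym/eqP.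
  by rewrite mulf_eq0 pnatr_eq0 /= => /eqP.
move=> n; apply/eqP; rewrite -normr_eq0 -[_ == _]negbK; apply/negP => an.
have {}an : 0 < `|a n 0| by rewrite lt_def an normr_ge0.
have [dn _] := (H 0 ltac:(by rewrite normr0) n).1.
have /cvgrPdist_lt/(_ _ an)/nbhs_ballP[d /= d0 Hd] :
    a n t @[t --> (0 : R)] --> a n 0.
  exact/differentiable_continuous/derivable1_diffP.
have key t : l < t < r -> `|t| < e -> `|t| < d -> False.
  move=> tlr te td; have := Hd t; rewrite /ball /= sub0r normrN => /(_ td).
  by rewrite (an0 n t tlr te) subr0 ltxx.
pose p := Num.min e d; have [pe pd] : p <= e /\ p <= d.
  by rewrite /p !ge_min !lexx orbT.
have p0 : 0 < p by rewrite lt_min e0.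
have [r1|r1] := ltP 0 r.
  pose q := Num.min p r; have [qp qr] : q <= p /\ q <= r.
    by split; rewrite /q ge_min lexx ?orbT.
  have q0 : 0 < q by rewrite lt_min p0.
  by apply: (key (q / 2)); rewrite ?ger0_norm; lra.
pose q := Num.min p (- l); have [qp qr] : q <= p /\ q <= - l.
  by split; rewrite /q ge_min lexx ?orbT.
have q0 : 0 < q by rewrite lt_min p0 oppr_gt0 (lt_le_trans lr).
by apply: (key (- (q / 2))); rewrite ?normrN ?ger0_norm; lra.
Qed.

End Analytic.

(** * Edge ratios of a face *)

Section FaceScales.
Variable R : realType.
Implicit Types (al be x y l u : R) (f g : R -> R).

(* The shape of a quadrilateral ABCD with
   [C - A = al *: (B - A) + be *: (D - A)]. *)
Definition quad_shape al be := [/\ 0 < al, 0 < be & 1 < al + be].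

Lemma quad_shape_sym al be : quad_shape al be -> quad_shape be al.
Proof. by case=> ? ? ?; split => //; rewrite addrC. Qed.

(* [x, y, l, u] are the ratios by which the edges AB, AD, BC, DC get multiplied
   in a parallel quadrilateral of the same area: the first two equations say
   that the edges close up, the third one is the equality of areas. *)
Definition face_scales al be x y l u : Prop :=
  [/\ 0 < x, 0 < y, 0 < l & 0 < u] /\
  [/\ x + l * (al - 1) = u * al, l * be = y + u * (be - 1) &
      x * l * be + y * u * al = al + be].

Lemma face_scales_sym al be x y l u :
  face_scales al be x y l u -> face_scales be al y x u l.
Proof.
by move=> [[? ? ? ?] [? ? ?]]; split; split => //; lra.
Qed.

(** The ratio of BC, obtained by solving the two closing equations. The ratio of DC follows by
    exchanging the roles of AB and AD. *)
Definition far_scale al be x y : R := (x * (be - 1) + al * y) / (al + be - 1).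

Lemma face_scales_far al be x y l u : quad_shape al be ->
  face_scales al be x y l u ->
  l = far_scale al be x y /\ u = far_scale be al y x.
Proof.
move=> [al0 be0 D0] [_ [e1 e2 _]].
have D : al + be - 1 != 0 by rewrite gt_eqF// subr_gt0.
have D' : be + al - 1 != 0 by rewrite [be + al]addrC.
split; [apply: (mulIf D)|apply: (mulIf D')]; rewrite /far_scale divfK//; nra.
Qed.

Lemma face_scales_inj al be x y y' l l' u u' : quad_shape al be ->
  face_scales al be x y l u -> face_scales al be x y' l' u' ->
  [/\ y = y', l = l' & u = u'].
Proof.
move=> s h h'.
have [[-> ->] [-> ->]] := (face_scales_far s h, face_scales_far s h').
suff -> : y = y' by [].
have [al0 be0 D0] := s.
case: h h' => [[x0 y0 l0 u0] [e1 e2 e3]] [[_ y'0 l'0 u'0] [f1 f2 f3]].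
(* With [x] fixed, the areas differ by [al * (u + u') * (y' - y)]. *)
have : al * (u + u') * (y' - y) = 0.
  have p1 := congr1 ( *%R (be * l')) e1; have p2 := congr1 ( *%R (be * l)) f1.
  have Ey' : y' = l' * be - u' * (be - 1) by lra.
  have Ey : y = l * be - u * (be - 1) by lra.
  rewrite Ey in e3 *; rewrite Ey' in f3 *; lra.
move=> /eqP; rewrite !mulf_eq0 subr_eq0 [al == 0]gt_eqF//.
rewrite [_ + _ == 0]gt_eqF ?addr_gt0//=.
by move=> /eqP ->.
Qed.

(* The far ratio [u] satisfies
   [al * (al + be - 1) * u ^+ 2 = be * x ^+ 2 + (al - 1) * (al + be)], and [y]
   is an affine function of [x] and [u] unless [al = 1], that is, unless AD and
   BC are parallel. *)
Definition near_scale al be x : R :=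
  if al == 1 then ((1 + be) / x - (be - 1) * x) / 2 else
  ((al + be - 1) * Num.sqrt ((be * x ^+ 2 + (al - 1) * (al + be)) /
                             (al * (al + be - 1))) - be * x) / (al - 1).

Lemma near_scale1 al be : quad_shape al be -> near_scale al be 1 = 1.
Proof.
move=> [al0 be0 D0]; rewrite /near_scale; case: eqVneq => [_|al1]; first by field.
have -> : (be * 1 ^+ 2 + (al - 1) * (al + be)) / (al * (al + be - 1)) = 1.
  by field; rewrite !gt_eqF//; lra.
by rewrite sqrtr1; field; rewrite subr_eq0.
Qed.

Lemma far_scale1 al be : quad_shape al be -> far_scale al be 1 1 = 1.
Proof. by move=> [? ? ?]; rewrite /far_scale; field; rewrite gt_eqF//; lra. Qed.

Lemma analytic0_near_scale al be f : quad_shape al be ->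
  analytic0 f -> f 0 = 1 -> analytic0 (fun t => near_scale al be (f t)).
Proof.
move=> [al0 be0 D0] af f0; rewrite /near_scale; case: eqVneq => [_|al1].
  apply: analytic0_mul (analytic0_cst _).
  apply: analytic0_add.
    apply: analytic0_mul (analytic0_cst _) (analytic0_inv af _).
    by rewrite f0 oner_eq0.
  apply/analytic0_opp/analytic0_mul => //; exact: analytic0_cst.
apply: analytic0_mul (analytic0_cst _).
apply: analytic0_add.
  apply: analytic0_mul (analytic0_cst _) _.
  apply: analytic0_sqrt; last first.
    rewrite f0 expr1n mulr1 divr_gt0 ?mulr_gt0//; nra.
  apply: analytic0_mul (analytic0_cst _).
  apply: analytic0_add (analytic0_cst _).
  by apply: analytic0_mul (analytic0_cst _) _; exact: analytic0_mul.
by apply/analytic0_opp/analytic0_mul => //; exact: analytic0_cst.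
Qed.

Lemma analytic0_far_scale al be f g : analytic0 f -> analytic0 g ->
  analytic0 (fun t => far_scale al be (f t) (g t)).
Proof.
move=> af ag; apply: analytic0_mul (analytic0_cst _); apply: analytic0_add.
  exact: analytic0_mul (analytic0_cst _).
exact: analytic0_mul (analytic0_cst _) ag.
Qed.

Lemma analytic0_gt0 f : analytic0 f -> 0 < f 0 ->
  \forall t \near (0 : R), 0 < f t.
Proof.
move=> af f0; have /cvgrPdist_lt /(_ _ f0) := analytic0_continuous0 af.
by apply: filterS => t; rewrite ltr_norml => /andP[_]; lra.
Qed.

(** If [al = 1], the area is affine in [y]. Otherwise it reduces to [(s ^+ 2 * (al * E) - be * x ^+
    2) / (al - 1)] with [s] the square root in [near_scale] and [E = al + be - 1], and the value of
    [s ^+ 2] finishes the computation. *)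
Lemma near_scale_area al be x (y := near_scale al be x) : quad_shape al be ->
  0 < x -> 0 < be * x ^+ 2 + (al - 1) * (al + be) ->
  x * far_scale al be x y * be + y * far_scale be al y x * al = al + be.
Proof.
move=> [al0 be0 D0] x0 r0.
have D : al + be - 1 != 0 by rewrite gt_eqF// subr_gt0.
rewrite {}/y /near_scale /far_scale; case: eqVneq => [->|al1].
  by field; rewrite addrK !gt_eqF.
set s := Num.sqrt _.
have : s ^+ 2 * (al * (al + be - 1)) = be * x ^+ 2 + (al - 1) * (al + be).
  rewrite sqr_sqrtr ?divfK// ?mulf_neq0//; first by rewrite gt_eqF.
  by rewrite ltW// divr_gt0// mulr_gt0// subr_gt0.
have -> : be + al - 1 = al + be - 1 by ring.
set E := al + be - 1 in D * => s2.
have al1' : al - 1 != 0 by rewrite subr_eq0.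
have -> : x * ((x * (be - 1) + al * ((E * s - be * x) / (al - 1))) / E) * be +
    (E * s - be * x) / (al - 1) *
    (((E * s - be * x) / (al - 1) * (al - 1) + be * x) / E) * al =
    (s ^+ 2 * (al * E) - be * x ^+ 2) / (al - 1).
  rewrite /E; field; rewrite al1' /=; lra.
by rewrite s2 addrAC subrr add0r mulrAC divff ?mul1r.
Qed.

Lemma near_scaleP al be f : quad_shape al be -> analytic0 f -> f 0 = 1 ->
  let g t := near_scale al be (f t) in
  \forall t \near (0 : R), face_scales al be (f t) (g t)
    (far_scale al be (f t) (g t)) (far_scale be al (g t) (f t)).
Proof.
move=> s af f0 g; have s' := quad_shape_sym s; have [al0 be0 D0] := s.
have D : al + be - 1 != 0 by rewrite gt_eqF// subr_gt0.
have D' : be + al - 1 != 0 by rewrite [be + al]addrC.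
have ag : analytic0 g by exact: analytic0_near_scale.
have g0 : g 0 = 1 by rewrite /g f0 near_scale1.
have fp := analytic0_gt0 af; have gp := analytic0_gt0 ag.
have lp := analytic0_gt0 (analytic0_far_scale al be af ag).
have up := analytic0_gt0 (analytic0_far_scale be al ag af).
rewrite f0 in fp; rewrite g0 in gp; rewrite f0 g0 far_scale1// in lp.
rewrite f0 g0 far_scale1// in up.
have /analytic0_gt0 rp : analytic0 (fun t => be * f t ^+ 2 + (al - 1) * (al + be)).
  apply: analytic0_add (analytic0_cst _).
  by apply: analytic0_mul (analytic0_cst _) _; exact: analytic0_mul.
have {}rp : \forall t \near (0 : R), 0 < be * f t ^+ 2 + (al - 1) * (al + be).
  by apply: rp; rewrite f0 expr1n mulr1; nra.
apply: filterS3 (filterI (fp ltr01) (gp ltr01)) (filterI (lp ltr01) (up ltr01)) rp.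
move=> t [ft gt] [lt ut] rt; split => //; split; last exact: near_scale_area.
  by rewrite /far_scale; field; lra.
by rewrite /far_scale; field; lra.
Qed.

End FaceScales.

(** * Edge ratios of a net *)

Lemma near_forall_ltn (T : Type) (F : set_system T) (FF : Filter F) (m : nat)
    (P : nat -> T -> Prop) :
  (forall i, (i < m)%N -> \forall t \near F, P i t) ->
  \forall t \near F, forall i, (i < m)%N -> P i t.
Proof.
elim: m => [|m ih] H; first exact: filterE.
have H1 : \forall t \near F, forall i, (i < m)%N -> P i t.
  by apply: ih => i im; apply: H; rewrite ltnS ltnW.
apply: filterS2 H1 (H m (ltnSn m)) => t h1 h2 i.
by rewrite ltnS leq_eqVlt => /predU1P[->//|]; exact: h1.
Qed.

Section NetScales.
Variable R : realType.
Implicit Types (h v : nat -> nat -> R) (i j m n : nat).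

(* [h i j] scales the edge from [P i j] to [P i.+1 j], [v i j] the one from
   [P i j] to [P i j.+1]. *)
Definition net_scales m n (al be h v : nat -> nat -> R) : Prop :=
  forall i j, (i < m)%N -> (j < n)%N ->
    face_scales (al i j) (be i j) (h i j) (v i j) (v i.+1 j) (h i j.+1).

Section Shape.
Variables al be : nat -> nat -> R.
Hypothesis shape : forall i j, quad_shape (al i j) (be i j).

Lemma face_scales1 i j : face_scales (al i j) (be i j) 1 1 1 1.
Proof. by split; split => //; lra. Qed.

(** The ratio travels along the bottom row of faces, from [h i 0] over the shared edge [v i.+1 0] to
    [h i.+1 0], and then up each column through opposite edges. *)
Lemma net_scales_unique m n h v h' v' : (0 < m)%N -> (0 < n)%N ->
  net_scales m n al be h v -> net_scales m n al be h' v' ->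
  h 0%N 0%N = h' 0%N 0%N ->
  (forall i j, (i < m)%N -> (j <= n)%N -> h i j = h' i j) /\
  (forall i j, (i <= m)%N -> (j < n)%N -> v i j = v' i j).
Proof.
move=> m0 n0 H H' h00.
have row0 i : (i < m)%N -> h i 0%N = h' i 0%N.
  elim: i => [//|i ih] im; have im' := ltnW im.
  have F := H i 0%N im' n0; have F' := H' i 0%N im' n0.
  rewrite -ih// in F'; have [_ Ev _] := face_scales_inj (shape i 0%N) F F'.
  have G := H i.+1 0%N im n0; have G' := H' i.+1 0%N im n0.
  rewrite -Ev in G'.
  by have [] := face_scales_inj (quad_shape_sym (shape i.+1 0%N))
    (face_scales_sym G) (face_scales_sym G').
have hE i j : (i < m)%N -> (j <= n)%N -> h i j = h' i j.
  move=> im; elim: j => [_|j ih jn]; first exact: row0.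
  have F := H i j im jn; have F' := H' i j im jn.
  rewrite -ih ?(ltnW jn)// in F'.
  by have [] := face_scales_inj (shape i j) F F'.
split=> // -[|i] j im jn.
  have F := H 0%N j m0 jn; have F' := H' 0%N j m0 jn.
  rewrite -hE ?(ltnW jn)// in F'.
  by have [] := face_scales_inj (shape 0%N j) F F'.
have F := H i j im jn; have F' := H' i j im jn.
rewrite -hE ?(ltnW jn)// in F'.
by have [] := face_scales_inj (shape i j) F F'.
Qed.

(** The candidate deformation, following the propagation in [net_scales_unique]; [t] is the
    deviation of the first ratio from 1. In the bottom row the next face is entered through its edge
    AD, whence the exchanged [be] and [al]. *)
Fixpoint row_scale i (t : R) : R :=
  if i is k.+1 then
    let x := row_scale k t in
    near_scale (be i 0%N) (al i 0%N)
      (far_scale (al k 0%N) (be k 0%N) x (near_scale (al k 0%N) (be k 0%N) x))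
  else 1 + t.

Fixpoint hscale i j (t : R) : R :=
  if j is k.+1 then
    let x := hscale i k t in
    far_scale (be i k) (al i k) (near_scale (al i k) (be i k) x) x
  else row_scale i t.

(** An inner vertical edge receives one ratio from the face on its right and another, [vscale], from
    the face on its left. Their agreement is the compatibility to be proved. *)
Definition vscale_right i j (t : R) : R :=
  near_scale (al i j) (be i j) (hscale i j t).

Definition vscale i j (t : R) : R :=
  if i is k.+1 then
    far_scale (al k j) (be k j) (hscale k j t) (vscale_right k j t)
  else vscale_right 0%N j t.

Lemma analytic0_row_scale i : analytic0 (row_scale i) /\ row_scale i 0 = 1.
Proof.
elim: i => [|i [ai i0]] /=.
  by split; [exact: analytic0_add (analytic0_cst 1) (analytic0_id R)|rewrite addr0].
rewrite i0 near_scale1// far_scale1// near_scale1; last exact: quad_shape_sym.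
split=> //; apply: analytic0_near_scale; first exact: quad_shape_sym.
  by apply: analytic0_far_scale => //; exact: analytic0_near_scale.
by rewrite i0 near_scale1// far_scale1.
Qed.

Lemma analytic0_hscale i j : analytic0 (hscale i j) /\ hscale i j 0 = 1.
Proof.
elim: j => [|j [aj j0]] /=; first exact: analytic0_row_scale.
rewrite j0 near_scale1// far_scale1; last exact: quad_shape_sym.
by split=> //; apply: analytic0_far_scale => //; exact: analytic0_near_scale.
Qed.

Lemma analytic0_vscale_right i j : analytic0 (vscale_right i j).
Proof. by have [ah h0] := analytic0_hscale i j; exact: analytic0_near_scale. Qed.

Lemma analytic0_vscale i j : analytic0 (vscale i j).
Proof.
case: i => [|i]; first exact: analytic0_vscale_right.
apply: analytic0_far_scale; last exact: analytic0_vscale_right.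
by have [] := analytic0_hscale i j.
Qed.

Lemma vscale0 i j : vscale i j 0 = 1.
Proof.
case: i => [|i]; rewrite /= /vscale_right (analytic0_hscale _ _).2 near_scale1//.
exact: far_scale1.
Qed.

Lemma hvscaleP i j : \forall t \near (0 : R), face_scales (al i j) (be i j)
  (hscale i j t) (vscale_right i j t) (vscale i.+1 j t) (hscale i j.+1 t).
Proof. by have [ah h0] := analytic0_hscale i j; exact: near_scaleP. Qed.

(** In the bottom row, [row_scale] was chosen so that the right face accepts the ratio coming from
    the left one; uniqueness identifies the two values. *)
Lemma vscale_row0 i :
  \forall t \near (0 : R), vscale i 0%N t = vscale_right i 0%N t.
Proof.
case: i => [|i]; first exact: filterE.
have [av v0] := (analytic0_vscale i.+1 0%N, vscale0 i.+1 0%N).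
have H := near_scaleP (quad_shape_sym (shape i.+1 0%N)) av v0.
apply: filterS2 H (hvscaleP i.+1 0%N) => t /face_scales_sym H H'.
by have [] := face_scales_inj (shape i.+1 0%N) H H'.
Qed.

End Shape.

(** * Closing up around an inner vertex *)

Definition net_face (al be h v : nat -> nat -> R) i j : Prop :=
  face_scales (al i j) (be i j) (h i j) (v i j) (v i.+1 j) (h i j.+1).

(* The four faces around a vertex fit together near the trivial deformation:
   [w] is the ratio of the edge shared by the faces (0,1) and (1,1), computed
   from the face (1,1). *)
Definition vertex_closed (al be : nat -> nat -> R) : Prop :=
  exists2 e : R, 0 < e & forall h v (w l u : R), `|h 0%N 0%N - 1| < e ->
    net_face al be h v 0 0 ->
    net_face al be h v 1 0 ->
    net_face al be h v 0 1 ->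
    face_scales (al 1%N 1%N) (be 1%N 1%N) (h 1%N 1%N) w l u -> v 1%N 1%N = w.

(** The two ratios of the edge shared by the faces (0,1) and (1,1) are analytic in [t]. The given
    nets make them agree on one side of 0, and the identity theorem extends this to a
    neighbourhood. *)
Lemma vertex_closedP al be (x1 : R) :
  (forall i j, quad_shape (al i j) (be i j)) -> x1 != 1 ->
  (forall x, Num.min 1 x1 <= x <= Num.max 1 x1 ->
     exists h v, net_scales 2 2 al be h v /\ h 0%N 0%N = x) ->
  vertex_closed al be.
Proof.
move=> shape x11 Hdef.
(* The first ratio determines the other three faces even before they are known to fit, with [w]
   standing for the second value of the shared edge. *)
have uniq h v h' v' (w l u w' l' u' : R) :
    net_face al be h v 0 0 ->
    net_face al be h v 1 0 ->
    net_face al be h v 0 1 ->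
    face_scales (al 1%N 1%N) (be 1%N 1%N) (h 1%N 1%N) w l u ->
    net_face al be h' v' 0 0 ->
    net_face al be h' v' 1 0 ->
    net_face al be h' v' 0 1 ->
    face_scales (al 1%N 1%N) (be 1%N 1%N) (h' 1%N 1%N) w' l' u' ->
    h 0%N 0%N = h' 0%N 0%N -> v 1%N 1%N = v' 1%N 1%N /\ w = w'.
  rewrite /net_face => F1 F2 F3 F4 G1 G2 G3 G4 E; rewrite -E in G1.
  have [_ E1 E2] := face_scales_inj (shape 0%N 0%N) F1 G1.
  rewrite -E1 in G2; rewrite -E2 in G3.
  have [_ E3 _] := face_scales_inj (quad_shape_sym (shape 1%N 0%N))
    (face_scales_sym F2) (face_scales_sym G2).
  rewrite -E3 in G4.
  have [_ E4 _] := face_scales_inj (shape 0%N 1%N) F3 G3.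
  by have [E5 _ _] := face_scales_inj (shape 1%N 1%N) F4 G4.
pose hs t i j := hscale al be i j t; pose vs t i j := vscale al be i j t.
pose w := vscale_right al be 1 1.
have faces : \forall t \near (0 : R), [/\
    net_face al be (hs t) (vs t) 0 0,
    net_face al be (hs t) (vs t) 1 0,
    net_face al be (hs t) (vs t) 0 1 &
    face_scales (al 1%N 1%N) (be 1%N 1%N) (hs t 1%N 1%N) (w t)
      (vs t 2%N 1%N) (hs t 1%N 2%N)].
  apply: filterS3 (filterI (hvscaleP shape 0%N 0%N) (hvscaleP shape 0%N 1%N))
    (filterI (hvscaleP shape 1%N 0%N) (vscale_row0 shape 1%N))
    (hvscaleP shape 1%N 1%N) => t [f1 f3] [f2 v1] f4.
  by split => //; rewrite /net_face /vs v1.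
have /nbhs_ballP[e e0 He] := faces; rewrite /= in e0.
(* In an actual net both values of the shared edge are [v 1 1], so by uniqueness the candidate
   values coincide as well. *)
have side (t : R) : `|t| < e -> Num.min 1 x1 <= 1 + t <= Num.max 1 x1 ->
    vs t 1%N 1%N - w t = 0.
  move=> te tx; have bt : ball 0 e t by rewrite /ball /= sub0r normrN.
  have [G1 G2 G3 G4] := He t bt.
  have [h [v [F h00]]] := Hdef _ tx.
  have F4 := F 1%N 1%N isT isT.
  have [E1 E2] := uniq h v (hs t) (vs t) _ _ _ _ _ _
    (F 0%N 0%N isT isT) (F 1%N 0%N isT isT) (F 0%N 1%N isT isT) F4
    G1 G2 G3 G4 h00.
  by rewrite -E1 -E2 subrr.
have close : \forall t \near (0 : R), vs t 1%N 1%N - w t = 0.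
  have ad : analytic0 (fun t => vs t 1%N 1%N - w t).
    apply: analytic0_add; first exact: (analytic0_vscale shape 1 1).
    exact/analytic0_opp/analytic0_vscale_right.
  have [x1g|x1l] := ltP 1 x1.
    apply: (@analytic0_eq0 _ _ 0 (Num.min e (x1 - 1)) ad).
    - by rewrite lt_min e0 subr_gt0.
    - by rewrite lexx /= le_min ltW// subr_ge0 ltW.
    move=> t /andP[t0]; rewrite lt_min => /andP[te tx]; apply: side.
      by rewrite gtr0_norm.
    by rewrite ge_min le_max; apply/andP; split; apply/orP; [left|right]; lra.
  have {}x1l : x1 < 1 by rewrite lt_neqAle x11.
  apply: (@analytic0_eq0 _ _ (- Num.min e (1 - x1)) 0 ad).
  - by rewrite oppr_lt0 lt_min e0 subr_gt0.
  - by rewrite lexx andbT oppr_le0 le_min ltW// subr_ge0 ltW.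
  move=> t /andP[t0 t1]; move: t0; rewrite ltrNl lt_min => /andP[te tx].
  apply: side; first by rewrite ltr0_norm.
  by rewrite ge_min le_max; apply/andP; split; apply/orP; [right|left]; lra.
have /nbhs_ballP[d d0 Hd] := @filterI _ _ (nbhs_filter (0 : R)) _ _ faces close.
exists d => // h v z l u hd F1 F2 F3 F4.
have bt : ball 0 d (h 0%N 0%N - 1) by rewrite /ball /= sub0r normrN.
have [[G1 G2 G3 G4] E] := Hd _ bt.
have hE : h 0%N 0%N = hs (h 0%N 0%N - 1) 0%N 0%N by rewrite /hs /= addrC subrK.
have [-> ->] := uniq h v (hs (h 0%N 0%N - 1))
  (vs (h 0%N 0%N - 1)) _ _ _ _ _ _ F1 F2 F3 F4 G1 G2 G3 G4 hE.
by apply/eqP; rewrite -subr_eq0 E.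
Qed.

(** The agreement of left and right ratios climbs each vertical line: it holds in the bottom row,
    and a closed vertex passes it from the edge below to the edge above. *)
Lemma hvscale_net al be m n : (forall i j, quad_shape (al i j) (be i j)) ->
  (forall i j, (i + 2 <= m)%N -> (j + 2 <= n)%N ->
     vertex_closed (fun k l => al (i + k)%N (j + l)%N)
                   (fun k l => be (i + k)%N (j + l)%N)) ->
  \forall t \near (0 : R), net_scales m n al be
    (fun i j => hscale al be i j t) (fun i j => vscale al be i j t).
Proof.
move=> shape Hv.
have key j i : (j < n)%N -> (i < m)%N ->
    \forall t \near (0 : R), vscale al be i j t = vscale_right al be i j t.
  move=> jn; case: i => [_|i im]; first exact: filterE.
  elim: j jn => [_|j ih jn]; first exact: vscale_row0.
  have [e e0 He] : vertex_closed (fun k l => al (i + k)%N (j + l)%N)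
                   (fun k l => be (i + k)%N (j + l)%N).
    by apply: Hv; rewrite addn2.
  have [ah h0] := analytic0_hscale shape i j.
  have /cvgrPdist_lt /(_ _ e0) := analytic0_continuous0 ah.
  rewrite h0 => hn.
  apply: filterS3 (filterI (hvscaleP shape i j) (hvscaleP shape i.+1 j))
    (filterI (hvscaleP shape i j.+1) (hvscaleP shape i.+1 j.+1))
    (filterI (ih (ltnW jn)) hn).
  move=> t [f1 f2] [f3 f4] [vE ht].
  (* On the leftmost line of the 2 x 2 block the right values are taken: [hvscaleP] then applies to
     the left faces without any agreement on that line. *)
  have := He (fun k l => hscale al be (i + k) (j + l) t)
    (fun k l => if k is 0 then vscale_right al be i (j + l) t
                else vscale al be (i + k) (j + l) t)
    (vscale_right al be i.+1 j.+1 t) (vscale al be i.+2 j.+1 t)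
    (hscale al be i.+1 j.+2 t).
  rewrite /net_face /= !addn0 !addn1 !addn2; apply => //; first by rewrite distrC.
  by rewrite vE.
have H j : (j < n)%N -> \forall t \near (0 : R), forall i, (i < m)%N ->
   face_scales (al i j) (be i j) (hscale al be i j t) (vscale al be i j t)
     (vscale al be i.+1 j t) (hscale al be i j.+1 t).
  move=> jn.
  apply: (near_forall_ltn (nbhs_filter (0 : R)) (P := fun i t => face_scales
    (al i j) (be i j) (hscale al be i j t) (vscale al be i j t)
    (vscale al be i.+1 j t) (hscale al be i j.+1 t))) => i im.
  by apply: filterS2 (key j i jn im) (hvscaleP shape i j) => t ->.
have := near_forall_ltn (nbhs_filter (0 : R)) H.
by apply: filterS => t Ht i j im jn; exact: Ht.
Qed.

End NetScales.

(** * Parallel quadrilaterals *)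

Section Quads.
Variables (R : realType) (d : nat).
Implicit Types (A B C D u v w : 'rV[R]_d) (al be x y l k : R).

Lemma dotC u v : dot u v = dot v u.
Proof. by apply: eq_bigr => i _; rewrite mulrC. Qed.

Lemma dotDl u v w : dot (u + v) w = dot u w + dot v w.
Proof. by rewrite -big_split; apply: eq_bigr => i _; rewrite mxE mulrDl. Qed.

Lemma dotZl x u w : dot (x *: u) w = x * dot u w.
Proof. by rewrite mulr_sumr; apply: eq_bigr => i _; rewrite mxE mulrA. Qed.

Lemma dotDr u v w : dot w (u + v) = dot w u + dot w v.
Proof. by rewrite dotC dotDl !(dotC w). Qed.

Lemma dotZr x u w : dot w (x *: u) = x * dot w u.
Proof. by rewrite dotC dotZl dotC. Qed.

Lemma dot_ge0 u : 0 <= dot u u.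
Proof. by apply: sumr_ge0 => i _; rewrite -expr2 sqr_ge0. Qed.

Lemma dot_gt0 u : u != 0 -> 0 < dot u u.
Proof.
move=> u0; rewrite lt_def dot_ge0 andbT; apply: contra u0.
rewrite psumr_eq0 => [/allP H|i _]; last by rewrite -expr2 sqr_ge0.
apply/eqP/rowP => i; rewrite mxE; apply/eqP.
by have := H i (mem_index_enum _); rewrite mulf_eq0 orbb.
Qed.

Definition independent u w := forall x y, x *: u + y *: w = 0 -> x = 0 /\ y = 0.

Lemma independent_inj u w (p q p' q' : R) : independent u w ->
  p *: u + q *: w = p' *: u + q' *: w -> p = p' /\ q = q'.
Proof.
move=> ind /eqP; rewrite -subr_eq0 opprD addrACA -!scalerBl => /eqP /ind.
by case=> /eqP + /eqP; rewrite !subr_eq0 => /eqP -> /eqP ->.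
Qed.

Lemma independent_neq0 u w : independent u w -> u != 0 /\ w != 0.
Proof.
move=> ind; split; apply/eqP => E.
  have [] := ind 1 0; first by rewrite E scaler0 scale0r addr0.
  by move=> /eqP; rewrite oner_eq0.
have [] := ind 0 1; first by rewrite E scaler0 scale0r addr0.
by move=> _ /eqP; rewrite oner_eq0.
Qed.

(** The squared area of the parallelogram spanned by [u] and [w]. *)
Definition gram u w := dot u u * dot w w - dot u w ^+ 2.

(** Strict Cauchy-Schwarz: the component of [w] orthogonal to [u], multiplied by [dot u u], is
    nonzero and has squared length [dot u u * gram u w]. *)
Lemma gram_gt0 u w : independent u w -> 0 < gram u w.
Proof.
move=> ind; have [u0 w0] := independent_neq0 ind.
have uu := dot_gt0 u0.
have : 0 < dot (dot u u *: w - dot u w *: u) (dot u u *: w - dot u w *: u).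
  apply: dot_gt0; apply/eqP => E.
  have [] := ind (- dot u w) (dot u u); first by rewrite scaleNr addrC.
  by move=> _ E'; rewrite E' ltxx in uu.
rewrite -scaleNr !(dotDl, dotDr, dotZl, dotZr) (dotC w u) => H.
rewrite -(pmulr_rgt0 _ uu) /gram; lra.
Qed.

Lemma gram_comb u w (p q p' q' : R) :
  gram (p *: u + q *: w) (p' *: u + q' *: w) =
  (p * q' - p' * q) ^+ 2 * gram u w.
Proof. by rewrite /gram !(dotDl, dotDr, dotZl, dotZr) (dotC w u); ring. Qed.

Lemma triangle_area_coords A B C u w (p q p' q' : R) :
  B - A = p *: u + q *: w -> C - A = p' *: u + q' *: w ->
  triangle_area A B C = `|p * q' - p' * q| * (Num.sqrt (gram u w) / 2).
Proof.
move=> eB eC; rewrite /triangle_area -/(gram (B - A) (C - A)) eB eC gram_comb.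
by rewrite sqrtrM ?sqr_ge0// sqrtr_sqr mulrA.
Qed.

Lemma quad_area_coords A B C D u w x y (p q : R) : 0 <= x -> 0 <= y ->
  0 <= p -> 0 <= q -> B - A = x *: u -> D - A = y *: w ->
  C - A = p *: u + q *: w ->
  quad_area A B C D = (x * q + y * p) * (Num.sqrt (gram u w) / 2).
Proof.
move=> x0 y0 p0 q0 eB eD eC.
have {}eB : B - A = x *: u + 0 *: w by rewrite eB scale0r addr0.
have {}eD : D - A = 0 *: u + y *: w by rewrite eD scale0r add0r.
rewrite /quad_area (triangle_area_coords eB eC) (triangle_area_coords eC eD).
by rewrite mulr0 mul0r !subr0 !ger0_norm ?mulr_ge0//; ring.
Qed.

Lemma collinear_det u w A B C (p q p' q' : R) : independent u w ->
  B - A = p *: u + q *: w -> C - A = p' *: u + q' *: w -> collinear A B C ->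
  p * q' - p' * q = 0.
Proof.
move=> ind eB eC [pt [v [a [b [c [eA' eB' eC']]]]]].
have EB : B - A = (b - a) *: v.
  by rewrite eA' eB' opprD addrACA subrr add0r scalerBl.
have EC : C - A = (c - a) *: v.
  by rewrite eA' eC' opprD addrACA subrr add0r scalerBl.
have : (c - a) *: (B - A) = (b - a) *: (C - A).
  by rewrite EB EC !scalerA mulrC.
rewrite eB eC !scalerDr !scalerA => /(independent_inj ind) [h1 h2].
have [ba|ba] := eqVneq (b - a) 0.
  have /(independent_inj ind) [-> ->] : p *: u + q *: w = 0 *: u + 0 *: w.
    by rewrite -eB EB ba !scale0r addr0.
  ring.
apply: (mulfI ba); rewrite mulr0.
have -> : (b - a) * (p * q' - p' * q) = ((b - a) * q') * p - ((b - a) * p') * q.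
  by ring.
by rewrite -h1 -h2; ring.
Qed.

(** The inequality places C beyond the line BD as seen from A. *)
Lemma convex_quad_coords A B C D u w x y (p q : R) : independent u w ->
  0 < x -> 0 < y -> 0 < p -> 0 < q -> x * y < p * y + q * x ->
  B - A = x *: u -> D - A = y *: w -> C - A = p *: u + q *: w ->
  convex_quad A B C D.
Proof.
move=> ind x0 y0 p0 q0 H eB eD eC.
have {}eB : B - A = x *: u + 0 *: w by rewrite eB scale0r addr0.
have {}eD : D - A = 0 *: u + y *: w by rewrite eD scale0r add0r.
have diff X Y (a b a' b' : R) : X - A = a *: u + b *: w ->
    Y - A = a' *: u + b' *: w -> Y - X = (a' - a) *: u + (b' - b) *: w.
  move=> eX eY; rewrite -(subrKA A) eY -opprB eX opprD addrACA -!scalerBl.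
  by [].
have eA : A - A = 0 *: u + 0 *: w by rewrite !scale0r addr0 subrr.
split.
- move=> /(collinear_det ind eB eC); nra.
- move=> /(collinear_det ind (diff _ _ _ _ _ _ eB eC)
    (diff _ _ _ _ _ _ eB eD)); nra.
- move=> /(collinear_det ind (diff _ _ _ _ _ _ eC eD)
    (diff _ _ _ _ _ _ eC eA)); nra.
- move=> /(collinear_det ind (diff _ _ _ _ _ _ eD eA)
    (diff _ _ _ _ _ _ eD eB)); nra.
have xy0 := mulr_gt0 x0 y0.
have E0 : 0 < p * y + q * x by lra.
(* The crossing of the diagonals solves [s * p = (1 - t) * x] and [s * q = t * y]. *)
exists (x * y / (p * y + q * x)), (q * x / (p * y + q * x)); split.
- by rewrite divr_gt0//= ltr_pdivrMr// mul1r.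
- by rewrite divr_gt0 ?mulr_gt0//= ltr_pdivrMr// mul1r ltrDr mulr_gt0.
rewrite (diff _ _ _ _ _ _ eB eD) eC.
have -> : B = A + (x *: u + 0 *: w) by rewrite -eB addrC subrK.
rewrite -addrA; congr (_ + _); rewrite !scalerDr !scalerA addrACA -!scalerDl.
by congr (_ *: u + _ *: w); field; rewrite gt_eqF.
Qed.

Definition quad_data A B C D al be :=
  independent (B - A) (D - A) /\ C - A = al *: (B - A) + be *: (D - A).

Lemma convex_quad_data A B C D : convex_quad A B C D ->
  exists al be, quad_shape al be /\ quad_data A B C D al be.
Proof.
move=> [_ _ _ ncol [s [t [/andP[s0 s1] /andP[t0 t1] E]]]].
(* The crossing point gives [s (C - A) = (1 - t) (B - A) + t (D - A)]; the two coefficients add up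
   to [1 / s], which exceeds 1. *)
exists ((1 - t) / s), (t / s); split; first split.
- by rewrite divr_gt0// subr_gt0.
- by rewrite divr_gt0.
- by rewrite -mulrDl subrK div1r invf_gt1.
split.
  move=> p q Epq; have [q0|q0] := eqVneq q 0.
    split=> //; apply/eqP; move: Epq; rewrite q0 scale0r addr0 => /eqP.
    rewrite scaler_eq0 subr_eq0 => /orP[//|/eqP BA]; exfalso; apply: ncol.
    exists A, (D - A), 1, 0, 0.
    by rewrite scale1r scale0r addr0 BA addrC subrK.
  exfalso; apply: ncol; exists A, (B - A), (- (p / q)), 0, 1.
  split; [|by rewrite scale0r addr0|by rewrite scale1r addrC subrK].
  rewrite -[LHS](subrK A) addrC; congr (_ + _); apply: (scalerI q0).
  by rewrite scalerA mulrN mulrCA divff// mulr1 scaleNr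
    -[RHS]add0r -Epq addrAC subrr add0r.
apply: (scalerI (lt0r_neq0 s0)).
have -> : s *: (C - A) = B + t *: (D - B) - A by rewrite -E addrAC subrr add0r.
rewrite [RHS]scalerDr !scalerA !(mulrCA s) divff ?gt_eqF// !mulr1.
have -> : D - B = (D - A) - (B - A) by rewrite opprB addrA subrK.
by rewrite scalerBr scalerBl scale1r addrAC [t *: _ - _]addrC addrA.
Qed.

Lemma quad_data_edges A B C D al be : quad_data A B C D al be ->
  C - B = (al - 1) *: (B - A) + be *: (D - A) /\
  C - D = al *: (B - A) + (be - 1) *: (D - A).
Proof.
move=> [_ E]; split.
  have -> : C - B = (C - A) - (B - A) by rewrite opprB addrA subrK.
  by rewrite E scalerBl scale1r addrAC.
have -> : C - D = (C - A) - (D - A) by rewrite opprB addrA subrK.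
by rewrite E scalerBl scale1r addrA.
Qed.

Section Parallel.
Variables (A B C D A' B' C' D' : 'rV[R]_d) (al be x y l k : R).
Hypotheses (shape : quad_shape al be) (ABCD : quad_data A B C D al be).
Hypotheses (eAB : B' - A' = x *: (B - A)) (eAD : D' - A' = y *: (D - A))
  (eBC : C' - B' = l *: (C - B)) (eDC : C' - D' = k *: (C - D)).

(** The diagonal is computed once through B' and once through D'; comparing coordinates gives the
    closing equations. *)
Lemma parallel_quad_diag :
  C' - A' = (k * al) *: (B - A) + (l * be) *: (D - A) /\
  (x + l * (al - 1) = k * al /\ l * be = y + k * (be - 1)).
Proof.
have [ind _] := ABCD; have [EC ED] := quad_data_edges ABCD.
have E1 : C' - A' = (x + l * (al - 1)) *: (B - A) + (l * be) *: (D - A).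
  by rewrite -(subrKA B') eBC eAB EC scalerDr !scalerA [x + _]addrC scalerDl addrAC.
have E2 : C' - A' = (k * al) *: (B - A) + (y + k * (be - 1)) *: (D - A).
  by rewrite -(subrKA D') eDC eAD ED scalerDr !scalerA [y + _]addrC scalerDl addrA.
have /(independent_inj ind) [h1 h2] := etrans (esym E1) E2.
by split=> //; rewrite E1 h1.
Qed.

Lemma quad_data_area :
  quad_area A B C D = (be + al) * (Num.sqrt (gram (B - A) (D - A)) / 2).
Proof.
have [al0 be0 _] := shape; have [_ E] := ABCD.
rewrite (@quad_area_coords A B C D (B - A) (D - A) 1 1 al be) ?scale1r ?ltW//.
by rewrite !mul1r.
Qed.

Hypotheses (x0 : 0 < x) (y0 : 0 < y) (l0 : 0 < l) (k0 : 0 < k).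

Lemma parallel_quad_area :
  quad_area A' B' C' D' = (x * (l * be) + y * (k * al)) *
    (Num.sqrt (gram (B - A) (D - A)) / 2).
Proof.
have [al0 be0 _] := shape; have [E _] := parallel_quad_diag.
by rewrite (quad_area_coords _ _ _ _ eAB eAD E) ?ltW ?mulr_gt0.
Qed.

Lemma parallel_quad_scales : quad_area A B C D = quad_area A' B' C' D' ->
  face_scales al be x y l k.
Proof.
have [ind _] := ABCD; have [_ [e1 e2]] := parallel_quad_diag.
rewrite quad_data_area parallel_quad_area => /mulIf E.
split; split => //;
  rewrite -[x * l * be]mulrA -[y * k * al]mulrA -E ?[al + be]addrC//.
by rewrite mulf_neq0 ?invr_eq0 ?pnatr_eq0// gt_eqF// sqrtr_gt0 gram_gt0.
Qed.

Lemma face_scales_quad_area : face_scales al be x y l k ->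
  quad_area A' B' C' D' = quad_area A B C D.
Proof.
move=> [_ [_ _ e]]; rewrite quad_data_area parallel_quad_area; congr (_ * _).
by rewrite !mulrA e addrC.
Qed.

Lemma parallel_quad_convex : convex_quad A' B' C' D'.
Proof.
have [ind _] := ABCD; have [al0 be0 D0] := shape.
have [E [e1 e2]] := parallel_quad_diag.
apply: (convex_quad_coords ind x0 y0 _ _ _ eAB eAD E); rewrite ?mulr_gt0//.
rewrite -subr_gt0.
have -> : k * al * y + l * be * x - x * y = l * k * (al + be - 1).
  have -> : x = k * al - l * (al - 1) by lra.
  have -> : y = l * be - k * (be - 1) by lra.
  by ring.
by rewrite !mulr_gt0// subr_gt0.
Qed.

End Parallel.

Lemma face_scales_close A B C D al be x y l k : quad_data A B C D al be ->
  face_scales al be x y l k ->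
  x *: (B - A) + l *: (C - B) - y *: (D - A) = k *: (C - D).
Proof.
move=> ABCD [_ [e1 e2 _]]; have [-> ->] := quad_data_edges ABCD.
move: (B - A) (D - A) => u w.
rewrite !scalerDr !scalerA addrA -scalerDl e1 e2 -addrA -scalerBl.
by congr (_ + _ *: _); ring.
Qed.

End Quads.

(** * Parallel nets *)

Lemma interval_IVT (R : realType) (I : set R) (f : R -> R) (s t y : R) :
  is_interval I -> {within I, continuous f} -> I s -> I t ->
  Num.min (f s) (f t) <= y <= Num.max (f s) (f t) -> exists2 r, I r & f r = y.
Proof.
move=> itv cf; wlog st : s t / s <= t => [H Is It|Is It yst].
  have [|/ltW] := leP s t; first by move=> /H; exact.
  by rewrite minC maxC => /H; exact.
have sub : `[s, t] `<=` I.
  by move=> r /=; rewrite in_itv /= => /(itv _ _ Is It).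
have [r rst <-] := IVT st (continuous_subspaceW sub cf) yst.
by exists r => //; exact: sub.
Qed.

Lemma interval_neq0_gt0 (R : realType) (I : set R) (f : R -> R) (s t : R) :
  is_interval I -> {within I, continuous f} -> (forall r, I r -> f r != 0) ->
  I s -> I t -> 0 < f s -> 0 < f t.
Proof.
move=> itv cf f0 Is It fs; rewrite ltNge; apply/negP => ft.
have [|r Ir fr] := interval_IVT (y := 0) itv cf Is It.
  by rewrite ge_min le_max ft orbT (ltW fs).
by have := f0 r Ir; rewrite fr eqxx.
Qed.

Section Nets.
Variables (R : realType) (d : nat).
Local Notation point := 'rV[R]_d.
Implicit Types (P Q : nat -> nat -> point) (m n i j : nat).

Definition hedge P i j := P i.+1 j - P i j.
Definition vedge P i j := P i j.+1 - P i j.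

Definition net_data m n P (al be : nat -> nat -> R) : Prop :=
  (forall i j, quad_shape (al i j) (be i j)) /\
  (forall i j, (i < m)%N -> (j < n)%N ->
    quad_data (P i j) (P i.+1 j) (P i.+1 j.+1) (P i j.+1) (al i j) (be i j)).

Lemma is_net_data m n P : is_net m n P -> exists al be, net_data m n P al be.
Proof.
move=> netP.
have /choice [f Hf] (ij : nat * nat) : exists ab : R * R,
    quad_shape ab.1 ab.2 /\ ((ij.1 < m)%N -> (ij.2 < n)%N ->
    quad_data (P ij.1 ij.2) (P ij.1.+1 ij.2) (P ij.1.+1 ij.2.+1) (P ij.1 ij.2.+1)
      ab.1 ab.2).
  have [/andP[im jn]|Nmn] := boolP ((ij.1 < m)%N && (ij.2 < n)%N).
    by have [al [be [s q]]] := convex_quad_data (netP _ _ im jn); exists (al, be).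
  (* Outside the grid any admissible shape will do; the parallelogram keeps [quad_shape] valid for
     all indices. *)
  exists (1, 1); split; first by split; rewrite //= ltrDl.
  by move=> im jn; rewrite im jn in Nmn.
exists (fun i j => (f (i, j)).1), (fun i j => (f (i, j)).2).
by split=> i j; [exact: (Hf (i, j)).1|exact: (Hf (i, j)).2].
Qed.

Lemma hedge_neq0 m n P al be : net_data m n P al be -> (0 < n)%N ->
  forall i j, (i < m)%N -> (j <= n)%N -> hedge P i j != 0.
Proof.
move=> [shape data] n0 i j im; case: j => [_|j jn].
  by have [/independent_neq0 []] := data i 0%N im n0.
have D := data i j im jn; have [ind _] := D; have [_] := quad_data_edges D.
have [al0 _ _] := shape i j.
rewrite /hedge => ->; apply/eqP => /ind [] /eqP.
by rewrite gt_eqF.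
Qed.

Lemma vedge_neq0 m n P al be : net_data m n P al be -> (0 < m)%N ->
  forall i j, (i <= m)%N -> (j < n)%N -> vedge P i j != 0.
Proof.
move=> [shape data] m0 i j + jn; case: i => [_|i im].
  by have [/independent_neq0 []] := data 0%N j m0 jn.
have D := data i j im jn; have [ind _] := D; have [+ _] := quad_data_edges D.
have [_ be0 _] := shape i j.
rewrite /vedge => ->; apply/eqP => /ind [] _ /eqP.
by rewrite gt_eqF.
Qed.

Definition scaled_edges m n P Q (h v : nat -> nat -> R) : Prop :=
  (forall i j, (i < m)%N -> (j <= n)%N -> hedge Q i j = h i j *: hedge P i j) /\
  (forall i j, (i <= m)%N -> (j < n)%N -> vedge Q i j = v i j *: vedge P i j).

Lemma scaled_edges_net m n P Q al be h v : net_data m n P al be ->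
  scaled_edges m n P Q h v -> net_scales m n al be h v ->
  is_net m n Q /\ same_areas m n P Q.
Proof.
move=> [shape data] [eh ev] hv; split=> i j im jn; have F := hv i j im jn;
  have [[h0 v0 l0 k0] _] := F;
  have E := (eh i j im (ltnW jn), ev i j (ltnW im) jn,
    ev i.+1 j im jn, eh i j.+1 im jn).
  exact: (parallel_quad_convex (shape i j) (data i j im jn)
    E.1.1.1 E.1.1.2 E.1.2 E.2).
by rewrite (face_scales_quad_area (shape i j) (data i j im jn)
    E.1.1.1 E.1.1.2 E.1.2 E.2).
Qed.

Lemma scaled_edges_scales m n P Q al be h v : net_data m n P al be ->
  scaled_edges m n P Q h v -> same_areas m n P Q ->
  (forall i j, (i < m)%N -> (j <= n)%N -> 0 < h i j) ->
  (forall i j, (i <= m)%N -> (j < n)%N -> 0 < v i j) ->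
  net_scales m n al be h v.
Proof.
move=> [shape data] [eh ev] ar h0 v0 i j im jn.
have E := (eh i j im (ltnW jn), ev i j (ltnW im) jn,
    ev i.+1 j im jn, eh i j.+1 im jn).
apply: (parallel_quad_scales (shape i j) (data i j im jn)
    E.1.1.1 E.1.1.2 E.1.2 E.2);
  by [exact: h0 (ltnW _)|exact: v0 (ltnW _) _|exact: v0|exact: h0|exact: ar].
Qed.

Lemma same_edges_translate m n P Q :
  scaled_edges m n P Q (fun _ _ => 1) (fun _ _ => 1) ->
  forall i j, (i <= m)%N -> (j <= n)%N ->
    P i j + (Q 0%N 0%N - P 0%N 0%N) = Q i j.
Proof.
move=> [eh ev].
have step (A B A' B' c : point) :
    A + c = A' -> B' - A' = 1 *: (B - A) -> B + c = B'.
  move=> <-; rewrite scale1r => /(canRL (subrK _)) ->.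
  by rewrite [A + c]addrC addrA addrAC subrK.
elim=> [|i ih] j im jn.
  elim: j jn => [_|j ih jn]; first by rewrite addrC subrK.
  exact: step (ih (ltnW jn)) (ev 0%N j im jn).
exact: step (ih j (ltnW im) jn) (eh i j im jn).
Qed.

Lemma same_edges_congruent m n P Q :
  scaled_edges m n P Q (fun _ _ => 1) (fun _ _ => 1) -> congruent m n P Q.
Proof.
move=> E; exists (fun A => A + (Q 0%N 0%N - P 0%N 0%N)).
  by move=> A B; rewrite /Defs.edist opprD addrACA subrr addr0.
exact: same_edges_translate E.
Qed.

Lemma dot_continuous (w : point) : continuous (fun u => dot u w).
Proof.
move=> u; rewrite /continuous_at /dot.
apply: (@cvg_big R _ +%R 0 xpredT _ _ (nbhs u)) => [|k _].
  exact: add_continuous.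
by apply: cvgM; [exact: coord_continuous|exact: cvg_cst].
Qed.

(** The ratio of the first edge is continuous in the parameter and equals 1 at the given net. If it
    were 1 at another parameter, all ratios would be 1 there and the nets would be translates,
    contrary to non-congruence. Intermediate values do the rest. *)
Lemma deformable_scales m n P al be : (0 < m)%N -> (0 < n)%N ->
  net_data m n P al be -> deformable m n P ->
  exists2 x1 : R, x1 != 1 & forall x, Num.min 1 x1 <= x <= Num.max 1 x1 ->
    exists h v, net_scales m n al be h v /\ h 0%N 0%N = x.
Proof.
move=> m0 n0 data [I [F [[itv [s [t [Is It st]]]] [t0 It0 E0] cF netF defF]]].
(* Projection recovers the factor [c] from [c *: u] as a continuous function of the parameter. *)
pose h r i j :=
  dot (hedge (F r) i j) (hedge P i j) / dot (hedge P i j) (hedge P i j).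
pose v r i j :=
  dot (vedge (F r) i j) (vedge P i j) / dot (vedge P i j) (vedge P i j).
have ratio (u w : point) : u != 0 -> parallel_vectors u w ->
    w = (dot w u / dot u u) *: u /\ dot w u / dot u u != 0.
  by move=> u0 [c c0 ->]; rewrite dotZl mulfK// gt_eqF// dot_gt0.
have hP := hedge_neq0 data n0; have vP := vedge_neq0 data m0.
have EH i j : (i < m)%N -> (j <= n)%N -> hedge (F t0) i j = hedge P i j.
  by move=> im jn; rewrite /hedge !E0// ltnW.
have EV i j : (i <= m)%N -> (j < n)%N -> vedge (F t0) i j = vedge P i j.
  by move=> im jn; rewrite /vedge !E0// ltnW.
have par r : I r -> (forall i j, (i < m)%N -> (j <= n)%N ->
      parallel_vectors (hedge P i j) (hedge (F r) i j)) /\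
    (forall i j, (i <= m)%N -> (j < n)%N ->
      parallel_vectors (vedge P i j) (vedge (F r) i j)).
  move=> Ir; have [->|r0] := eqVneq r t0.
    by split=> i j im jn; exists 1; rewrite ?oner_eq0// scale1r ?EH ?EV.
  rewrite eq_sym in r0; have [[ph pv] _ _] := defF t0 r It0 Ir r0.
  by split=> i j im jn; [rewrite -EH//; exact: ph|rewrite -EV//; exact: pv].
have area r : I r -> same_areas m n P (F r).
  move=> Ir i j im jn; rewrite -!E0 ?(ltnW im) ?(ltnW jn)//.
  have [->//|r0] := eqVneq r t0; rewrite eq_sym in r0.
  by have [_ ar _] := defF t0 r It0 Ir r0; exact: ar.
have cdot (i j i' j' : nat) (w : point) : (i <= m)%N -> (j <= n)%N ->
    (i' <= m)%N -> (j' <= n)%N ->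
    {within I, continuous (fun r => dot (F r i j - F r i' j') w / dot w w)}.
  move=> im jn im' jn'; have c1 := cF i j im jn; have c2 := cF i' j' im' jn'.
  suff : continuous (fun r : subspace I => dot (F r i j - F r i' j') w / dot w w).
    by [].
  move=> r; rewrite /continuous_at.
  apply: (@cvgM R (subspace I) (nbhs r)) (cvg_cst _).
  apply: (@continuous_comp (subspace I) point R) (@dot_continuous w _).
  by apply: (@cvgB R point (subspace I) (nbhs r)); [exact: c1|exact: c2].
have edges r : I r -> scaled_edges m n P (F r) (h r) (v r).
  move=> Ir; have [ph pv] := par r Ir; split=> i j im jn.
    by have [] := ratio _ _ (hP i j im jn) (ph i j im jn).
  by have [] := ratio _ _ (vP i j im jn) (pv i j im jn).
(* Parallel edges might point in opposite directions, but a nonvanishing continuous ratio that is 1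
   at [t0] stays positive on the interval. *)
have h_gt0 r i j : I r -> (i < m)%N -> (j <= n)%N -> 0 < h r i j.
  move=> Ir im jn.
  apply: (@interval_neq0_gt0 _ I (fun r => h r i j) t0 r) => //.
  - exact: (cdot _ _ _ _ _ im jn (ltnW im) jn).
  - move=> r' Ir'; have [ph _] := par r' Ir'.
    by have [] := ratio _ _ (hP i j im jn) (ph i j im jn).
  - by rewrite /h EH// divff// gt_eqF// dot_gt0// hP.
have v_gt0 r i j : I r -> (i <= m)%N -> (j < n)%N -> 0 < v r i j.
  move=> Ir im jn.
  apply: (@interval_neq0_gt0 _ I (fun r => v r i j) t0 r) => //.
  - exact: (cdot _ _ _ _ _ im jn im (ltnW jn)).
  - move=> r' Ir'; have [_ pv] := par r' Ir'.
    by have [] := ratio _ _ (vP i j im jn) (pv i j im jn).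
  - by rewrite /v EV// divff// gt_eqF// dot_gt0// vP.
have scales r : I r -> net_scales m n al be (h r) (v r).
  move=> Ir; apply: (scaled_edges_scales data (edges r Ir) (area r Ir)) => *.
    exact: h_gt0.
  exact: v_gt0.
have h1 : h t0 0%N 0%N = 1.
  by rewrite /h EH// divff// gt_eqF// dot_gt0// hP.
have [t1 It1 ht1] : exists2 t1, I t1 & h t1 0%N 0%N != 1.
  have [t1 It1 t10] : exists2 t1, I t1 & t0 != t1.
    have [Et|] := eqVneq t0 s; last by exists s.
    by exists t => //; rewrite Et lt_eqF.
  exists t1 => //; apply/eqP => ht1.
  have [_ _] := defF t0 t1 It0 It1 t10; apply.
  have [shape _] := data.
  have ones : net_scales m n al be (fun _ _ => 1) (fun _ _ => 1).
    by move=> i j _ _; exact: face_scales1.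
  have [Eh Ev] := net_scales_unique shape m0 n0 (scales t1 It1) ones ht1.
  have [eh ev] := edges t1 It1.
  apply: same_edges_congruent; split=> i j im jn.
    by rewrite eh// Eh// EH.
  by rewrite ev// Ev// EV.
exists (h t1 0%N 0%N) => // x xh.
have ch : {within I, continuous (fun r => h r 0%N 0%N)}.
  exact: (cdot _ _ _ _ _ m0 (leq0n n) (leq0n m) (leq0n n)).
have [|r Ir hr] := interval_IVT (y := x) itv ch It0 It1; first by rewrite h1.
by exists (h r), (v r); split => //; exact: scales.
Qed.

(** The point is reached from the fixed corner along the bottom row and then up its own vertical
    line. *)
Definition scaled_net P (h v : nat -> nat -> R) : nat -> nat -> point :=
  fun i j => P 0%N 0%N + \sum_(k < i) h k 0%N *: hedge P k 0%N +
             \sum_(l < j) v i l *: vedge P i l.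

(** Vertical edges and the bottom row are right by construction. The other horizontal edges follow
    by induction on [j], as each face closes up. *)
Lemma scaled_netP m n P al be h v : net_data m n P al be ->
  net_scales m n al be h v -> scaled_edges m n P (scaled_net P h v) h v.
Proof.
move=> [_ data] hv.
have ev i j : vedge (scaled_net P h v) i j = v i j *: vedge P i j.
  by rewrite {1}/vedge /scaled_net big_ord_recr /= addrA [X in X - _]addrC addrK.
split=> i j im; last by rewrite ev.
elim: j => [_|j ih jn].
  rewrite {1}/hedge /scaled_net !big_ord0 !addr0 big_ord_recr /= addrA.
  by rewrite [X in X - _]addrC addrK.
have F := hv i j im jn.
have <- : _ = h i j.+1 *: hedge P i j.+1 := face_scales_close (data i j im jn) F.
rewrite -/(hedge P i j) -/(vedge P i.+1 j) -/(vedge P i j) -ih ?(ltnW jn)//.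
rewrite -!ev /hedge /vedge; apply/esym.
by rewrite [X in X - _]addrC addrA subrK opprB addrA subrK.
Qed.

Lemma net_scales_gt0 m n al be h v : (0 < m)%N -> (0 < n)%N ->
  net_scales m n al be h v ->
  (forall i j, (i < m)%N -> (j <= n)%N -> 0 < h i j :> R) /\
  (forall i j, (i <= m)%N -> (j < n)%N -> 0 < v i j).
Proof.
move=> m0 n0 hv; split=> [i [|j] im jn|[|i] j im jn].
- by have [[]] := hv i 0%N im n0.
- by have [[]] := hv i j im jn.
- by have [[]] := hv 0%N j m0 jn.
- by have [[]] := hv i j im jn.
Qed.

Lemma scaled_edges_parallel m n P Q Q' h v h' v' :
  scaled_edges m n P Q h v -> scaled_edges m n P Q' h' v' ->
  (forall i j, (i < m)%N -> (j <= n)%N -> 0 < h i j /\ 0 < h' i j) ->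
  (forall i j, (i <= m)%N -> (j < n)%N -> 0 < v i j /\ 0 < v' i j) ->
  parallel_nets m n Q Q'.
Proof.
move=> [eh ev] [eh' ev'] h0 v0; split=> i j im jn.
- have [p p'] := h0 i j im jn; exists (h' i j / h i j).
    by rewrite gt_eqF// divr_gt0.
  have := eh' i j im jn; rewrite /hedge => ->.
  have := eh i j im jn; rewrite /hedge => ->.
  by rewrite scalerA divfK// gt_eqF.
- have [p p'] := v0 i j im jn; exists (v' i j / v i j).
    by rewrite gt_eqF// divr_gt0.
  have := ev' i j im jn; rewrite /vedge => ->.
  have := ev i j im jn; rewrite /vedge => ->.
  by rewrite scalerA divfK// gt_eqF.
Qed.

Lemma scaled_net_continuous P (h v : R -> nat -> nat -> R) (t : R) i j :
  (forall k, (k < i)%N -> {for t, continuous (fun s => h s k 0%N)}) ->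
  (forall l, (l < j)%N -> {for t, continuous (fun s => v s i l)}) ->
  {for t, continuous (fun s => scaled_net P (h s) (v s) i j)}.
Proof.
move=> ch cv; rewrite /scaled_net.
apply: (@cvgD R point R (nbhs t)).
  apply: (@cvgD R point R (nbhs t)); first exact: cvg_cst.
  apply: (@cvg_big point _ +%R 0 xpredT _ R (nbhs t)) => [|k _].
    exact: add_continuous.
  by apply: (@cvgZr_tmp R point R (nbhs t)); exact: ch.
apply: (@cvg_big point _ +%R 0 xpredT _ R (nbhs t)) => [|k _].
  exact: add_continuous.
by apply: (@cvgZr_tmp R point R (nbhs t)); exact: cv.
Qed.

End Nets.

Theorem lemma3p9 (R : realType) (d m n : nat)
    (P : nat -> nat -> 'rV[R]_d)
    (m_gt0 : (0 < m)%N) (n_gt0 : (0 < n)%N)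
    (P_net : is_net m n P)
    (sub_deformable : forall p q : nat, (p + 2 <= m)%N -> (q + 2 <= n)%N ->
       deformable 2 2 (subnet p q P)) :
  deformable m n P.
Proof.
have [al [be data]] := is_net_data P_net; have [shape fdata] := data.
have vertices i j : (i + 2 <= m)%N -> (j + 2 <= n)%N ->
    vertex_closed (fun k l => al (i + k)%N (j + l)%N)
                  (fun k l => be (i + k)%N (j + l)%N).
  move=> im jn.
  have sub : net_data 2 2 (subnet i j P) (fun k l => al (i + k)%N (j + l)%N)
      (fun k l => be (i + k)%N (j + l)%N).
    split=> [k l|k l k2 l2]; first exact: shape.
    rewrite /subnet !addnS; apply: fdata.
      by apply: leq_trans im; rewrite ltn_add2l.
    by apply: leq_trans jn; rewrite ltn_add2l.
  have [x1 x11 H] := @deformable_scales R d 2 2 _ _ _ isT isT sub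
    (sub_deformable i j im jn).
  by apply: (vertex_closedP _ x11) => // k l; exact: shape.
have Hnet := hvscale_net shape vertices.
pose h t i j := hscale al be i j t; pose v t i j := vscale al be i j t.
have ch : \forall t \near (0 : R), forall i, (i < m.+1)%N ->
    forall j, (j < n.+1)%N ->
    {for t, continuous (hscale al be i j)} /\
    {for t, continuous (vscale al be i j)}.
  apply: (near_forall_ltn (nbhs_filter (0 : R)) (P := fun i t => forall j,
    (j < n.+1)%N -> {for t, continuous (hscale al be i j)} /\
     {for t, continuous (vscale al be i j)})) => i _.
  apply: (near_forall_ltn (nbhs_filter (0 : R)) (P := fun j t =>
    {for t, continuous (hscale al be i j)} /\
     {for t, continuous (vscale al be i j)})) => j _.
  have [ah _] := analytic0_hscale shape i j.
  exact: filterI (analytic0_continuous ah)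
    (analytic0_continuous (analytic0_vscale shape i j)).
have /nbhs_ballP[e e0 He] := @filterI _ _ (nbhs_filter (0 : R)) _ _ Hnet ch.
rewrite /= in e0.
(* The parameter is the deviation of the first ratio from 1, and the given net sits at the interior
   parameter 0. *)
pose I : set R := [set` `](- e), e[].
have {}He t : I t -> net_scales m n al be (h t) (v t) /\
    forall i j, (i <= m)%N -> (j <= n)%N ->
    {for t, continuous (hscale al be i j)} /\
    {for t, continuous (vscale al be i j)}.
  move=> te; have [|H1 H2] := He t.
    by move: te; rewrite /I /ball /= sub0r normrN in_itv /= ltr_norml.
  by split => // i j im jn; exact: H2.
pose F t := scaled_net P (h t) (v t).
have edges t : I t -> scaled_edges m n P (F t) (h t) (v t).
  by move=> /He [H _]; exact: scaled_netP data H.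
have h00 t : h t 0%N 0%N = 1 + t by [].
have gt0 t (It : I t) := net_scales_gt0 m_gt0 n_gt0 (He t It).1.
have I0 : I 0 by rewrite /I /= in_itv /= oppr_lt0 e0.
exists I, F; split.
- split; first exact: interval_is_interval.
  by exists 0, (e / 2); split; rewrite /I /= ?in_itv /=; lra.
- exists 0 => // i j im jn.
  have [eh ev] := edges 0 I0.
  (* At parameter 0 all ratios are 1, so the net is a translate of [P], and the corner is fixed. *)
  rewrite -[LHS](@same_edges_translate R d m n P (F 0)) //.
    by rewrite /F /scaled_net !big_ord0 !addr0 subrr addr0.
  split=> k l km ln; rewrite ?eh ?ev// /h /v ?vscale0//.
  by have [_ ->] := analytic0_hscale shape k l.
- move=> i j im jn; apply: continuous_in_subspaceT => t /set_mem It.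
  apply: scaled_net_continuous => [k ki|l lj].
    by have [] := (He t It).2 k 0%N (ltnW (leq_trans ki im)) isT.
  by have [] := (He t It).2 i l im (ltnW (leq_trans lj jn)).
- by move=> t It; have [] := scaled_edges_net data (edges t It) (He t It).1.
move=> s t Is It st; split.
- have [hs vs] := gt0 s Is; have [ht vt] := gt0 t It.
  by apply: (scaled_edges_parallel (edges s Is) (edges t It)) => i j im jn;
    split; [exact: hs|exact: ht|exact: vs|exact: vt].
- move=> i j im jn.
  have [_ As] := scaled_edges_net data (edges s Is) (He s Is).1.
  have [_ At] := scaled_edges_net data (edges t It) (He t It).1.
  by rewrite -As// -At.
(* An isometry preserves the length of the first edge, which is [1 + t] times the original one, so
   distinct parameters give non-congruent nets. *)
move=> [f fiso fE].
have := fiso (F s 0%N 0%N) (F s 1%N 0%N); rewrite !fE// /Defs.edist.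
have [[ehs _] [eht _]] := (edges s Is, edges t It).
rewrite -[F s _ _ - _]/(hedge (F s) 0%N 0%N) -[F t _ _ - _]/(hedge (F t) 0%N 0%N).
rewrite ehs// eht// !(dotZl, dotZr) !mulrA -!expr2.
rewrite !(sqrtrM _ (sqr_ge0 _)) !sqrtr_sqr.
have [[hs _] [ht _]] := (gt0 s Is, gt0 t It).
have E0 : Num.sqrt (dot (hedge P 0%N 0%N) (hedge P 0%N 0%N)) != 0.
  by rewrite gt_eqF// sqrtr_gt0 dot_gt0// (hedge_neq0 data n_gt0).
move=> /(mulIf E0); rewrite !gtr0_norm ?hs ?ht// !h00 => /addrI ts.
by rewrite ts eqxx in st.
Qed.
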